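(* Let $x:[t_0,+\infty)\to\mathcal H$ be a solution trajectory of $$\dot x(t)+\frac{d}{dt}\Phi_t(x(t))+\Phi_t(x(t))=0,\qquad \Phi_t(z):=V(z)+\varepsilon(t)\nabla h(z),\quad \varepsilon(t)=\frac{c}{t^\delta},$$ and let $x^*$ be an optimal solution of the problem of minimizing $h(x)$ subject to $V(x)=0$. The following statements hold. (i) If $V$ satisfies the Attouch--Czarnecki-type condition and $\delta>\frac12$, then $\|V(x(t))\|=o\left(\frac1{\sqrt t}\right)$ as $t\to+\infty$. (ii) If $V$ satisfies the Attouch--Czarnecki-type condition and $\delta=\frac12$, then, as $t\to+\infty$, $$\|V(x(t))\|=\mathcal O\left(\frac1{\sqrt t}\right),\qquad \langle x(t)-x^*,V(x(t))\rangle=o\left(\frac1{\sqrt t}\right),\qquad h(x(t))\to h(x^* ).$$ Furthermore, $x(t)$ converges weakly, as $t\to+\infty$, to an optimal solution of the bilevel problem. (iii) If $V$ satisfies the sharpness condition with exponent $\rho\in(1,2)$ and $\frac1{\rho^*}<\delta<\frac12$, where $\frac1\rho+\frac1{\rho^*}=1$, then, as $t\to+\infty$, $$\|V(x(t))\|=\mathcal O\left(\frac1{t^\delta}\right),\qquad \langle x(t)-x^*,V(x(t))\rangle=o\left(\frac1{\sqrt t}\right),\qquad |h(x(t))-h(x^* )|=o\left(\frac1{t^{\frac12-\delta}}\right).$$ Furthermore, $x(t)$ converges weakly, as $t\to+\infty$, to an optimal solution of the bilevel problem.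
   Context: $\mathcal H$ is a real Hilbert space. $h:\mathcal H\to\mathbb R$ is convex, continuously Fréchet differentiable and bounded below, and $\nabla h$ is bounded on bounded subsets of $\mathcal H$. $V:\mathcal H\to\mathcal H$ is continuous and monotone ($\langle V(x)-V(y),x-y\rangle\ge0$ for all $x,y$). $\operatorname{zer}V:=\{x: V(x)=0\}$ (a closed convex set). The bilevel problem is: minimize $h(x)$ subject to $V(x)=0$; an optimal solution is a point $x^*\in\operatorname{zer}V$ with $h(x^* )\le h(x)$ for all $x\in\operatorname{zer}V$. Constants $c,\delta,t_0>0$ are fixed. A solution trajectory is a map $x:[t_0,+\infty)\to\mathcal H$ such that $x$ and $t\mapsto\Phi_t(x(t))$ are differentiable on $[t_0,+\infty)$ (one-sided at $t_0$) and the differential equation holds for every $t\ge t_0$. Notation: $N_{\operatorname{zer}V}(x^* )=\{p\in\mathcal H:\langle p,x-x^*\rangle\le0\ \forall x\in\operatorname{zer}V\}$; $\sigma_{\operatorname{zer}V}(u)=\sup_{y\in\operatorname{zer}V}\langle y,u\rangle$; the Fitzpatrick function of $V$ is $\mathcal F_V(x,u)=\sup_{y\in\mathcal H}\{\langle y,u\rangle+\langle x,V(y)\rangle-\langle y,V(y)\rangle\}$. Attouch--Czarnecki-type condition: for every optimal solution $x^*$ of the bilevel problem and every $p^*\in N_{\operatorname{zer}V}(x^* )$, $$\int_{t_0}^{+\infty}\Bigl[\mathcal F_V(x^*,\varepsilon(t)p^* )-\sigma_{\operatorname{zer}V}(\varepsilon(t)p^* )\Bigr]dt<+\infty$$ (the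 integrand is nonnegative). Sharpness condition with exponent $\rho\in(1,2)$: for every optimal solution $x^*$ of the bilevel problem there exists $\tau>0$ such that $\frac\tau\rho\operatorname{dist}(x,\operatorname{zer}V)^\rho\le\langle x-x^*,V(x)\rangle$ for all $x\in\mathcal H$. *)

(* Defs.v *)
From HB Require Import structures.
From mathcomp Require Import all_boot all_order all_algebra sesquilinear.
From mathcomp Require Import all_classical all_reals all_analysis.

Set Implicit Arguments.
Unset Strict Implicit.
Unset Printing Implicit Defensive.

Import Order.TTheory GRing.Theory Num.Theory.
Import numFieldNormedType.Exports.

Local Open Scope classical_set_scope.
Local Open Scope ring_scope.

(* Needed to write f =o_F g and f =O_F g for t --> +oo. *)
Canonical pinfty_filter_on (R : realType) : filter_on R :=
  FilterType (pinfty_nbhs R) _.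

(* A real Hilbert space is a complete normed module H over R together with a
   positive definite symmetric form [dot] that induces the norm of H. *)
Definition induces_norm (R : realType) (H : completeNormedModType R)
    (dot : {dot H for idfun}) :=
  forall u : H, `|u| = Num.sqrt (dot u u).

Section Hilbert.
Context {R : realType} {H : completeNormedModType R}.
Variable dot : {dot H for idfun}.
Implicit Types (h : H -> R) (V gradh : H -> H) (A : set H) (x p u : H).

Definition is_gradient h gradh :=
  forall x, differentiable (h : H -> R^o) x /\
    forall v, 'd (h : H -> R^o) x v = dot (gradh x) v.

Definition monotone_operator V := forall x y, 0 <= dot (V x - V y) (x - y).

Definition zer V : set H := [set x | V x = 0].

Definition optimal_solution h V x :=
  zer V x /\ forall y, zer V y -> h x <= h y.

Definition normal_cone A x : set H :=
  [set p | forall y, A y -> dot p (y - x) <= 0].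

Definition support_function A u : \bar R :=
  ereal_sup [set (dot y u)%:E | y in A].

Definition fitzpatrick V x u : \bar R :=
  ereal_sup [set (dot y u + dot x (V y) - dot y (V y))%:E | y in [set: H]].

Definition dist x A : R := inf [set `|x - y| | y in A].

(* When x is optimal and p is in the normal cone, the support function is
   finite at every e(t)p, so the subtraction below is never +oo - +oo. *)
Definition attouch_czarnecki h V (e : R -> R) (t0 : R) :=
  forall x p, optimal_solution h V x -> normal_cone (zer V) x p ->
  (\int[lebesgue_measure]_(t in `[t0, +oo[)
     (fitzpatrick V x (e t *: p) - support_function (zer V) (e t *: p))
   < +oo)%E.

Definition sharpness h V (rho : R) :=
  forall xs, optimal_solution h V xs ->
  exists2 tau : R, 0 < tau &
    forall x, tau / rho * dist x (zer V) `^ rho <= dot (x - xs) (V x).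

Definition weakly_converges_at_pinfty (x : R -> H) (l : H) :=
  forall y, dot (x t) y @[t --> +oo_R] --> dot l y.

End Hilbert.

(* Derivative relative to D: two-sided at interior points of D, one-sided at
   the left endpoint of D = [t0, +oo[. The values of f outside D are ignored. *)
Definition has_derivative_within (R : realType) (H : normedModType R)
    (D : set R) (f : R -> H) (t : R) (l : H) :=
  (s - t)^-1 *: (f s - f t) @[s --> within D t^'] --> l.

Definition epsilon (R : realType) (c delta t : R) : R := c / t `^ delta.

Definition Phi (R : realType) (H : normedModType R) (V gradh : H -> H)
    (e : R -> R) (t : R) (z : H) : H :=
  V z + e t *: gradh z.

Definition solution_trajectory (R : realType) (H : normedModType R)
    (V gradh : H -> H) (e : R -> R) (t0 : R) (x : R -> H) :=
  forall t, t0 <= t -> exists dx dPhi : H,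
    [/\ has_derivative_within `[t0, +oo[ x t dx,
        has_derivative_within `[t0, +oo[
          (fun s => Phi V gradh e s (x s)) t dPhi &
        dx + dPhi + Phi V gradh e t (x t) = 0].

(* Main.v *)
Require Import Defs.
From mathcomp Require Import all_boot all_order all_algebra sesquilinear.
From mathcomp Require Import all_classical all_reals all_analysis.
From mathcomp Require Import ring lra.
Set Implicit Arguments.
Unset Strict Implicit.
Unset Printing Implicit Defensive.
Import Order.TTheory GRing.Theory Num.Theory.
Import numFieldNormedType.Exports.
Local Open Scope classical_set_scope.
Local Open Scope ring_scope.

(** Write [F t = V (x t) + e t *: gradh (x t)] for the residual and
    [z t = x t + F t]. The equation says [z' = - F], and [x t] is the resolvent
    of a monotone operator at [z t], so [z] behaves like a proximal iteration.

    Two estimates carry the proof. For an optimal point [w], the derivative of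
    [|z - w| ^ 2] is [- 2 <x - w, F> - 2 |F| ^ 2], and [<x - w, F>] is bounded
    below by [<x - w, V x> + e <gradh w, x - w>]. The negative part of this
    bound is dominated by some [k] with a bounded primitive [K]: under the
    Attouch--Czarnecki-type condition because [- gradh w] is normal to [zer V]
    at [w] and the gap between the Fitzpatrick and support functions dominates
    it pointwise; under sharpness because Young's inequality gives
    [k t = C / t ^ (delta rho_star)] with exponent above 1. Hence
    [|z - w| ^ 2 - 2 K] is nonincreasing, [x] is bounded and [|z - w|]
    converges for every optimal [w].

    On the other side, monotonicity of [V] and [gradh] gives
    [<x', F'> >= e' <x', gradh x>], so [|F| ^ 2] decreases up to the error
    [- 2 e' (h o x)'], which is integrated by parts. As a result
    [t |F| ^ 2] plus a vanishing term plus [|z - w| ^ 2 - 2 K] is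
    nonincreasing, so [t |F| ^ 2] converges; a positive limit would make
    [|z - w| ^ 2 - 2 K] decrease like [- ln t]. Thus [|F| = o(1 / sqrt t)] for
    every [delta] ([residual_cvg]).

    The rates follow. [|V x| <= |F| + e |gradh x|] gives those of [V x]. As
    [<x - xs, V x> + e (h x - h xs) <= <x - xs, F> = o(1 / sqrt t)] with a
    nonnegative first term, it remains to bound [e (h x - h xs)] from below: for
    [delta = 1/2] by weak lower semicontinuity of [h], for sharp problems by
    half of the first term and a power of [t]. Weak convergence is Opial's
    argument. Weak limits are taken along ultrafilters finer than the
    neighbourhoods of +oo: each ultrafilter gives a weak limit by the Riesz
    representation theorem ([ultra_weak_limit]), each such limit is optimal, and
    the convergence of the distances to optimal points makes all of them
    equal. *)

(** * Inner product and derivatives *)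

Section InnerProduct.
Context {R : realType} {H : completeNormedModType R}.
Context (dot : {dot H for idfun}) (dot_norm : induces_norm dot).
Implicit Types (u v w : H) (a b : R).

Lemma dotC u v : dot u v = dot v u.
Proof. by rewrite hermitian_subproof expr0 mul1r. Qed.

Lemma dotDl u v w : dot (u + v) w = dot u w + dot v w.
Proof. exact: linearDl. Qed.

Lemma dotDr u v w : dot w (u + v) = dot w u + dot w v.
Proof. by rewrite dotC dotDl !(dotC w). Qed.

Lemma dotNl u v : dot (- u) v = - dot u v.
Proof. exact: linearNl. Qed.

Lemma dotNr u v : dot v (- u) = - dot v u.
Proof. by rewrite dotC dotNl (dotC v). Qed.

Lemma dotZl a u v : dot (a *: u) v = a * dot u v.
Proof. exact: linearZl_LR. Qed.

Lemma dotZr a u v : dot v (a *: u) = a * dot v u.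
Proof. by rewrite dotC dotZl (dotC v). Qed.

Lemma dot0l u : dot 0 u = 0.
Proof. exact: linear0l. Qed.

Lemma dot0r u : dot u 0 = 0.
Proof. by rewrite dotC dot0l. Qed.

Definition dotE := (dotDl, dotDr, dotNl, dotNr, dotZl, dotZr).

Lemma dot_ge0 u : 0 <= dot u u.
Proof.
have [->|u0] := eqVneq u 0; first by rewrite dot0l.
by apply: ltW; apply: neq0_dnorm_gt0.
Qed.

Lemma dot_sqr u : dot u u = `|u| ^+ 2.
Proof. by rewrite dot_norm sqr_sqrtr// dot_ge0. Qed.

(** Cauchy--Schwarz: expand the square of [|v| u - |u| v]. *)
Lemma dot_le u v : dot u v <= `|u| * `|v|.
Proof.
have [->|u0] := eqVneq u 0; first by rewrite dot0l normr0 mul0r.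
have [->|v0] := eqVneq v 0; first by rewrite dot0r normr0 mulr0.
have u_gt0 : 0 < `|u| by rewrite normr_gt0.
have v_gt0 : 0 < `|v| by rewrite normr_gt0.
have := dot_ge0 (`|v| *: u - `|u| *: v).
rewrite !dotE !dot_sqr (dotC v u) => h.
have {h} : 0 <= 2 * (`|u| * `|v|) * (`|u| * `|v| - dot u v) by lra.
by rewrite pmulr_rge0 ?subr_ge0// !mulr_gt0.
Qed.

Lemma normr_dot u v : `|dot u v| <= `|u| * `|v|.
Proof.
rewrite ler_norml dot_le andbT lerNl -dotNl.
by rewrite (le_trans (dot_le _ _))// normrN.
Qed.

Lemma cvg_dot (T : Type) (F : set_system T) {FF : Filter F} (f g : T -> H) u v :
  f @ F --> u -> g @ F --> v -> dot (f t) (g t) @[t --> F] --> dot u v.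
Proof.
move=> fu gv.
rewrite -[dot u v]addr0.
have -> : (fun t => dot (f t) (g t)) =
    (fun t => dot u v + (dot (f t - u) (g t) + dot u (g t - v))).
  by apply/funext => t; rewrite !dotE; ring.
apply: cvgD; first exact: cvg_cst.
apply: norm_cvg0.
have fu0 : `|f t - u| @[t --> F] --> 0.
  apply/norm_cvg0P; rewrite -(subrr u).
  by apply: cvgB => //; exact: cvg_cst.
have gv0 : `|g t - v| @[t --> F] --> 0.
  apply/norm_cvg0P; rewrite -(subrr v).
  by apply: cvgB => //; exact: cvg_cst.
apply: (@squeeze_cvgr _ _ _ _ (fun=> 0 : R)
  (fun t => `|f t - u| * `|g t| + `|u| * `|g t - v|)); last 2 first.
- exact: cvg_cst.
- rewrite (_ : 0 = 0 * `|v| + `|u| * 0); last by rewrite mul0r mulr0 addr0.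
  by apply: cvgD; apply: cvgM => //; [exact: cvg_norm|exact: cvg_cst].
near=> t; rewrite normr_ge0/= (le_trans (ler_normD _ _))//.
by rewrite lerD ?normr_dot.
Unshelve. all: by end_near. Qed.

End InnerProduct.

(** The difference quotients of [has_derivative_within] are based at the moving
    point [s], those of [is_derive] at the increment. *)
Lemma is_derive_dnbhs (R : realType) (W : normedModType R) (f : R -> W)
    (t : R) d : is_derive t (1 : R) f d <->
  (s - t)^-1 *: (f s - f t) @[s --> t^'] --> d.
Proof.
have E : (fun h => h^-1 *: ((f \o shift t) (h *: (1 : R)) - f t)) @ 0^' =
   (s - t)^-1 *: (f s - f t) @[s --> t^'].
  rewrite funeqE => A; apply/propext; rewrite /within/= /nbhs/=.
  change ((\forall h \near (0:R), h != 0 -> A (h^-1 *: (f (h *: (1:R) + t) - f t))) <-> (\forall s \near t, s != t -> A ((s-t)^-1 *: (f s - f t)))).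
  rewrite (near_shift 0 t) subr0.
  have Q (h : R) : (h != 0 -> A (h^-1 *: (f (h *: (1:R) + t) - f t))) <->
     (h + t != t -> A ((h + t - t)^-1 *: (f (h + t) - f t))).
    by rewrite -(subr_eq0 (h + t)) addrK [h *: 1]mulr1.
  by split; apply: filterS => h /= /Q.
split=> [[+ <-]|fd]; first by rewrite /derivable /derive E => /cvgP.
by split; rewrite /derivable /derive E; [apply/cvg_ex; exists d|exact/cvg_lim].
Qed.

Lemma is_derive_continuous (R : realType) (W : normedModType R) (f : R -> W)
    (t : R) d : is_derive t (1 : R) f d -> {for t, continuous f}.
Proof. by move=> fd; apply/differentiable_continuous/derivable1_diffP. Qed.

Lemma has_derivative_within_is_derive (R : realType) (W : normedModType R)
    (f : R -> W) (t0 t : R) d : t0 < t ->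
  has_derivative_within `[t0, +oo[ f t d -> is_derive t (1 : R) f d.
Proof.
move=> t0t fd; apply/is_derive_dnbhs; apply: cvg_trans fd.
apply: cvg_app; have : \forall s \near t, t0 < s by exact: lt_nbhsr.
move=> t0s A At; apply: filterS2 t0s At => s t0s + st; apply=> //=.
by rewrite in_itv/= andbT ltW.
Qed.

Section Calculus.
Context {R : realType} {H : completeNormedModType R}.
Context (dot : {dot H for idfun}) (dot_norm : induces_norm dot).
Implicit Types (u v w : H) (a b : R).

Lemma is_derive_dot (f g : R -> H) (t : R) df dg :
  is_derive t (1 : R) f df -> is_derive t (1 : R) g dg ->
  is_derive t (1 : R) (fun s => dot (f s) (g s)) (dot df (g t) + dot (f t) dg).
Proof.
move=> fd gd; apply/is_derive_dnbhs.
have -> : (fun s => (s - t)^-1 *: (dot (f s) (g s) - dot (f t) (g t))) =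
    (fun s => dot ((s - t)^-1 *: (f s - f t)) (g s) +
              dot (f t) ((s - t)^-1 *: (g s - g t))).
  by apply/funext => s; rewrite !dotE /GRing.scale/=; ring.
apply: cvgD; apply: cvg_dot => //.
- exact/is_derive_dnbhs.
- by apply: cvg_within_filter; exact: is_derive_continuous gd.
- exact: cvg_cst.
- exact/is_derive_dnbhs.
Qed.

Lemma is_derive_gradient (h : H -> R) (gradh : H -> H) (f : R -> H) (t : R) df :
  is_gradient dot h gradh -> is_derive t (1 : R) f df ->
  is_derive t (1 : R) (h \o f) (dot (gradh (f t)) df).
Proof.
move=> gh fd; have [dh dhE] := gh (f t).
have df' : differentiable f t by apply/derivable1_diffP.
have dhf : differentiable ((h : H -> R^o) \o f) t by exact: differentiable_comp.
split; first exact/derivable1_diffP.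
rewrite deriveE// diff_comp//= dhE -deriveE//.
by rewrite derive_val.
Qed.

Lemma gradient_direction (h : H -> R) (gradh : H -> H) u v :
  is_gradient dot h gradh ->
  s^-1 * (h (u + s *: v) - h u) @[s --> 0^'+] --> dot (gradh u) v.
Proof.
move=> gh; pose f (s : R) := u + s *: v.
have fd : is_derive (0 : R) (1 : R) f v.
  apply/is_derive_dnbhs; apply: cvg_near_cst.
  apply: filterS (nbhs_dnbhs_neq (0 : R)) => s s0.
  by rewrite /f subr0 scale0r addr0 addrAC subrr add0r scalerA mulVf ?scale1r.
have := is_derive_gradient gh fd; rewrite {2}/f scale0r addr0.
move=> /is_derive_dnbhs /cvg_dnbhs_at_right; apply: cvg_trans.
by apply: near_eq_cvg; near=> s; rewrite /= /f subr0 scale0r addr0.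
Unshelve. all: by end_near. Qed.

End Calculus.

Section ConvexGradient.
Context {R : realType} {H : completeNormedModType R}.
Context (dot : {dot H for idfun}) (dot_norm : induces_norm dot).
Context (h : H -> R) (gradh : H -> H).
Context (h_convex : convex_function [set: convex_lmodType H] h)
  (h_grad : is_gradient dot h gradh).

(** Convexity bounds the difference quotients of [h] along the segment from [x]
    to [y], and their limit is the left-hand inner product. *)
Lemma gradient_le x y : h x + dot (gradh x) (y - x) <= h y.
Proof.
rewrite addrC -lerBrDr.
apply: (cvgr_to_le (gradient_direction (u := x) (v := y - x) h_grad)).
near=> s.
have s0 : 0 < s by near: s; exact: nbhs_right_gt.
have s1 : s < 1 by near: s; exact: nbhs_right_lt.
have := h_convex (Itv01 (ltW s0) (ltW s1)) (in_setT y) (in_setT x).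
rewrite convRE /= /conv/= /unstable.onem => hc.
have -> : x + s *: (y - x) = s *: y + (1 - s) *: x.
  by rewrite scalerBr scalerBl scale1r addrCA addrA.
by rewrite mulrC ler_pdivrMr//; lra.
Unshelve. all: by end_near. Qed.

Lemma gradient_monotone x y : 0 <= dot (gradh x - gradh y) (x - y).
Proof. by have := gradient_le x y; have := gradient_le y x; rewrite !dotE; lra. Qed.

End ConvexGradient.

(** * Weak limits along ultrafilters and Minty's trick *)

(** Statements about the filter [F] can be checked along each ultrafilter finer
    than it, because a set whose complement is frequently visited is missed by
    one of them. Ultrafilters replace the extraction of subsequences below. *)
Lemma near_of_ultra (T : Type) (F : set_system T) (A : set T) : Filter F ->
  (forall U : set_system T, UltraFilter U -> F `<=` U -> U A) -> F A.
Proof.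
move=> FF allU; apply: contrapT => nFA.
have FP : ProperFilter (within (~` A) F).
  apply: Build_ProperFilter => n0; apply: nFA.
  have : F [set t | ~ A t -> False] := n0.
  by apply: filterS => t; apply: contrapT.
have [U [UU FU]] := ultraFilterLemma FP.
have UnA : U (~` A) by apply: FU; exact: withinT.
have UA : U A by apply: allU => // B FB; apply: FU; exact: (@cvg_within _ F _ _ B FB).
by have [t []] := filter_ex (filterI UA UnA).
Qed.

(** Along an ultrafilter, a cluster point of a function is a limit. *)
Lemma ultra_bounded_cvg (R : realType) (T : Type) (U : set_system T) (f : T -> R) (M : R) :
  UltraFilter U -> (\forall t \near U, `|f t| <= M) -> exists l : R, f t @[t --> U] --> l.
Proof.
move=> UU fM; have UP : ProperFilter U by apply: ultra_proper.
have : (f @ U) `[- M, M]%classic.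
  by apply: filterS fM => t /=; rewrite in_itv/= -ler_norml.
move=> /(@segment_compact _ (- M) M (f @ U) _) [l [_ lcl]].
exists l => B Bl.
have [//|UnB] := in_ultra_setVsetC (f @^-1` B) UU.
by have [y [/= ? ?]] := lcl (~` B) B UnB Bl.
Qed.

Section WeakLimits.
Context {R : realType} {H : completeNormedModType R}.
Context (dot : {dot H for idfun}) (dot_norm : induces_norm dot).
Implicit Types (u v w : H) (a b : R).

(** The representative minimizes [dot u u / 2 - L u]: by the parallelogram
    identity minimizing sequences are Cauchy, and the first-order condition at
    the minimum is the representation formula. *)
Lemma riesz (L : H -> R) M :
  (forall u v, L (u + v) = L u + L v) -> (forall a u, L (a *: u) = a * L u) ->
  (forall u, `|L u| <= M * `|u|) -> exists w, forall v, L v = dot w v.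
Proof.
move=> LD LZ LM.
have LN u : L (- u) = - L u by rewrite -scaleN1r LZ mulN1r.
pose J u := dot u u / 2 - L u.
have J_lb u : - (M ^+ 2 / 2) <= J u.
  rewrite /J (dot_sqr dot_norm).
  have := le_trans (ler_norm _) (LM u); have := sqr_ge0 (M - `|u|); nra.
pose m := inf (range J).
have Jhas : has_inf (range J).
  by split; [exists (J 0), 0|exists (- (M ^+ 2 / 2)) => _ [u _ <-]].
have mJ u : m <= J u by apply: ge_inf; [case: Jhas|exists u].
have min_ n : exists u, J u < m + n.+1%:R^-1.
  have [|_ [u _ <-] ?] := @inf_adherent _ (range J) n.+1%:R^-1 _ Jhas => //.
  by exists u.
pose y n := projT1 (cid (min_ n)).
have yJ n : J (y n) < m + n.+1%:R^-1 by exact: projT2 (cid (min_ n)).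
have gap u v : `|u - v| ^+ 2 = 4 * (J u + J v - 2 * J (2^-1 *: (u + v))).
  rewrite /J -(dot_sqr dot_norm) !dotE !LZ !LD (dotC dot v u).
  by field.
have gap_le u v : `|u - v| ^+ 2 <= 4 * ((J u - m) + (J v - m)).
  by rewrite gap; have := mJ (2^-1 *: (u + v)); lra.
have ycauchy : cauchy (y n @[n --> \oo]).
  apply: cauchy_exP => _/posnumP[e].
  have e8 : 0 < e%:num ^+ 2 / 8 by [].
  near \oo => N; exists (y N).
  suff : \forall n \near \oo, ball (y N) e%:num (y n) by [].
  near=> n.
  rewrite -ball_normE /ball_/=.
  rewrite -ltr_sqr ?nnegrE// (le_lt_trans (gap_le _ _))//.
  have := yJ N; have := yJ n.
  have : (n.+1%:R^-1 : R) < e%:num ^+ 2 / 8.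
    by near: n; exact: (near_infty_natSinv_lt (PosNum e8)).
  have : (N.+1%:R^-1 : R) < e%:num ^+ 2 / 8.
    by near: N; exact: (near_infty_natSinv_lt (PosNum e8)).
  move: (N.+1%:R^-1) (n.+1%:R^-1) (J _) (J _) (e%:num ^+ 2) => a b Jn JN E; lra.
have /cvg_ex[/= w yw] : cvg (y n @[n --> \oo]) by exact/cauchy_cvgP.
have Lyw : L (y n) @[n --> \oo] --> L w.
  apply/cvgrPdist_le => e e0.
  have M1 : 0 < `|M| + 1 by rewrite ltr_wpDl.
  have e1 : 0 < e / (`|M| + 1) by rewrite divr_gt0.
  move/cvgrPdist_le : yw => /(_ _ e1); apply: filterS => n ywn.
  rewrite -LN -LD (le_trans (LM _))//.
  have := ler_norm M; have := normr_ge0 (w - y n).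
  move: ywn; rewrite ler_pdivlMr//; nra.
have Jyw : J (y n) @[n --> \oo] --> J w.
  by apply: cvgB => //; apply: cvgM; [exact: cvg_dot|exact: cvg_cst].
have Jw : J w <= m.
  rewrite -[m]addr0; apply: (ler_cvg_to Jyw).
    by apply: cvgD; [exact: cvg_cst|exact: (@cvg_harmonic R)].
  by near=> n; rewrite ltW.
exists w => v.
pose d := dot w v - L v; pose q := dot v v.
have q0 : 0 <= q by exact: dot_ge0.
(* the quadratic s |-> J (w + s v) - J w is nonnegative; its value at this s
   is at most - d ^ 2 / (2 (q + 1)) *)
have := le_trans Jw (mJ (w + (- (d / (q + 1))) *: v)).
rewrite /J !dotE LD LZ (dotC dot v w) -/q.
set r := d / (q + 1) => h.
have dr : d = r * (q + 1) by rewrite /r divfK// gt_eqF// ltr_wpDl.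
have dw : dot w v = L v + r * (q + 1) by rewrite -dr /d; ring.
have r0 : r ^+ 2 * (q / 2 + 1) <= 0 by move: h; rewrite dw; lra.
have : r ^+ 2 = 0 by have := sqr_ge0 r; nra.
by move/eqP; rewrite sqrf_eq0 dw => /eqP ->; rewrite mul0r addr0.
Unshelve. all: by end_near. Qed.

(** An ultrafilter turns every bounded scalar function into a convergent one,
    and the resulting functional is represented by a point: along an
    ultrafilter, bounded sets are weakly compact. *)
Lemma ultra_weak_limit (T : Type) (U : set_system T) (x : T -> H) (M : R) :
  UltraFilter U -> (\forall t \near U, `|x t| <= M) ->
  exists w, forall v, dot (x t) v @[t --> U] --> dot w v.
Proof.
move=> UU xM; have UP : ProperFilter U by apply: ultra_proper.
have xv v : exists l : R, dot (x t) v @[t --> U] --> l.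
  apply: (@ultra_bounded_cvg _ _ _ _ (M * `|v|)).
  apply: filterS xM => t xM; rewrite (le_trans (normr_dot dot_norm _ _))//.
  by rewrite ler_wpM2r.
pose L v := projT1 (cid (xv v)).
have Lcvg v : dot (x t) v @[t --> U] --> L v by exact: projT2 (cid (xv v)).
have Luniq v (l : R) : dot (x t) v @[t --> U] --> l -> L v = l.
  by move=> h; exact: (cvg_unique _ (Lcvg v) h).
have [|||w Lw] := @riesz L M.
- move=> u v; apply: Luniq; under eq_fun do rewrite dotDr.
  exact: cvgD.
- move=> a u; apply: Luniq; under eq_fun do rewrite dotZr.
  by apply: cvgM => //; exact: cvg_cst.
- move=> u; apply: (cvgr_to_le (cvg_norm (Lcvg u))).
  apply: filterS xM => t xM; rewrite (le_trans (normr_dot dot_norm _ _))//.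
  by rewrite ler_wpM2r.
by exists w => v; rewrite -Lw.
Qed.

End WeakLimits.

Section Minty.
Context {R : realType} {H : completeNormedModType R}.
Context (dot : {dot H for idfun}) (dot_norm : induces_norm dot).
Context (V : H -> H).
Context (V_cont : continuous V) (V_mono : monotone_operator dot V).

(** Minty's trick: the inequality at [y = w - s V w] gives
    [<V w, V (w - s V w)> <= 0], hence [|V w| ^ 2 <= 0] as [s] tends to 0. *)
Lemma minty w : (forall y, 0 <= dot (V y) (y - w)) -> V w = 0.
Proof.
move=> hw.
pose f (s : R) := w - s *: V w.
have f0 : f s @[s --> 0^'+] --> w.
  rewrite -[w in X in _ --> X]subr0 -(scale0r (V w)).
  apply: cvgB; first exact: cvg_cst.
  apply: cvgZ; last exact: cvg_cst.
  by apply: cvg_at_right_filter.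
have Vf : dot (V (f s)) (V w) @[s --> 0^'+] --> dot (V w) (V w).
  by apply: cvg_dot => //; [apply: continuous_cvg => //; exact: V_cont|exact: cvg_cst].
have : dot (V w) (V w) <= 0.
  apply: (cvgr_to_le Vf).
  near=> s.
  have s0 : 0 < s by near: s; exact: nbhs_right_gt.
  have := hw (f s); rewrite /f addrAC subrr add0r !dotE.
  by rewrite oppr_ge0 pmulr_rle0.
by rewrite (dot_sqr dot_norm) exprn_even_le0//= normr_eq0 => /eqP.
Unshelve. all: by end_near. Qed.

Lemma zer_dot_ge0 x y : zer V x -> 0 <= dot (V y) (y - x).
Proof. by move=> xV; have := V_mono y x; rewrite xV subr0. Qed.

Lemma zer_convex x y (s : R) : 0 <= s <= 1 ->
  zer V x -> zer V y -> zer V (x + s *: (y - x)).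
Proof.
move=> /andP[s0 s1] xV yV; apply: minty => u.
have := zer_dot_ge0 u xV; have := zer_dot_ge0 u yV.
rewrite !dotE; nra.
Qed.

(** The graph of [V] is closed for weak convergence of the points and strong
    convergence of the values: pass to the limit in the monotonicity inequality
    and apply Minty's trick. *)
Lemma zer_weak_limit (T : Type) (F : set_system T) (x : T -> H) w (M : R) :
  ProperFilter F -> (\forall t \near F, `|x t| <= M) ->
  (forall v, dot (x t) v @[t --> F] --> dot w v) ->
  V (x t) @[t --> F] --> 0 -> zer V w.
Proof.
move=> FF xM xw V0; apply: minty => y.
have Vx0 : `|V (x t)| * (M + `|y|) @[t --> F] --> 0.
  rewrite -(mul0r (M + `|y|)) -(normr0 H).
  by apply: cvgM; [exact: cvg_norm|exact: cvg_cst].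
have lim : `|V (x t)| * (M + `|y|) - (dot (x t) (V y) - dot y (V y)) @[t --> F]
    --> 0 - (dot w (V y) - dot y (V y)).
  apply: cvgB => //; apply: cvgB => //; exact: cvg_cst.
have -> : dot (V y) (y - w) = 0 - (dot w (V y) - dot y (V y)).
  by rewrite !dotE !(dotC dot (V y)); ring.
apply: (cvgr_to_ge lim); apply: filterS xM => t xM.
have := V_mono (x t) y; rewrite !dotE => mono.
have : dot (V (x t)) (x t - y) <= `|V (x t)| * (M + `|y|).
  rewrite (le_trans (dot_le dot_norm _ _))// ler_wpM2l//.
  by rewrite (le_trans (ler_normB _ _))// lerD2r.
rewrite !dotE !(dotC dot (V y)) in mono *; lra.
Qed.

End Minty.

(** * Real functions and the velocity inequality *)

Section RealFunctions.
Context {R : realType}.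
Implicit Types (f g : R -> R) (a s t : R).

Lemma is_derive_add f g t df dg : is_derive t (1 : R) f df ->
  is_derive t (1 : R) g dg ->
  is_derive t (1 : R) (fun s => f s + g s) (df + dg).
Proof. by move=> fd gd; exact: is_deriveD. Qed.

Lemma is_derive_mul f g t df dg : is_derive t (1 : R) f df ->
  is_derive t (1 : R) g dg ->
  is_derive t (1 : R) (fun s => f s * g s) (df * g t + f t * dg).
Proof.
move=> fd gd; have /is_derive_eq := is_deriveM fd gd; apply.
by rewrite /GRing.scale/= addrC (mulrC (g t)).
Qed.

(** The derivative is only required to exist with the right sign, without a
    chosen derivative function, since the derivatives of a trajectory are given
    existentially. *)
Lemma nonincreasing_of_derive f a :
  (forall t, a < t -> exists2 d, is_derive t (1 : R) f d & d <= 0) ->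
  forall s t, a < s -> s <= t -> f t <= f s.
Proof.
move=> fd s t sa st.
have [||r] := @MVT_segment _ f ('D_1 f) s t st.
- move=> r /[!in_itv]/= /andP[sr _]; apply/derivableP.
  by have [d [] //] := fd r (lt_trans sa sr).
- apply: continuous_in_subspaceT => r /[!inE]/= /[!in_itv]/= /andP[sr _].
  by have [d /is_derive_continuous] := fd r (lt_le_trans sa sr).
rewrite in_itv/= => /andP[sr _] E; rewrite -subr_le0 E.
have [d rd d0] := fd r (lt_le_trans sa sr).
by rewrite mulr_le0_ge0 ?subr_ge0// derive_val.
Qed.

Lemma nonincreasing_bounded_cvg f a (m : R) :
  (forall s t, a < s -> s <= t -> f t <= f s) ->
  (forall t, a < t -> m <= f t) ->
  exists l : R, f t @[t --> +oo] --> l.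
Proof.
move=> fdec fm; pose g t := - f (Num.max t (a + 1)).
have a1 t : a < Num.max t (a + 1) by rewrite lt_max ltrDl ltr01 orbT.
have gcvg : g t @[t --> +oo] --> sup (range g).
  apply: nondecreasing_cvgr.
    by move=> s t st; rewrite lerN2 fdec// ge_max !le_max st lexx orbT.
  by exists (- m) => _ [t _ <-]; rewrite lerN2 fm.
exists (- sup (range g)); move/cvgN : gcvg; apply: cvg_trans.
apply: near_eq_cvg.
apply: filterS (nbhs_pinfty_ge (num_real (a + 1))) => t at1.
by rewrite /g opprK max_l.
Qed.

Lemma epsilon_gt0 (c delta t : R) : 0 < c -> 0 < t -> 0 < epsilon c delta t.
Proof. by move=> c0 t0; rewrite divr_gt0// powR_gt0. Qed.

Lemma is_derive_epsilon (c delta t : R) : 0 < t ->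
  is_derive t (1 : R) (epsilon c delta) (- (delta * epsilon c delta t / t)).
Proof.
move=> t0.
have td : t `^ delta != 0 by rewrite gt_eqF// powR_gt0.
have := @is_deriveV _ (fun r : R => powR r delta) _ _ _ td (is_derive1_powR delta t0).
move=> /(is_derive_mul (is_derive_cst c t 1)); rewrite mul0r add0r.
move=> /is_derive_eq; apply.
have tn0 : t != 0 by rewrite gt_eqF.
have -> : t `^ (delta - 1) = t `^ delta / t.
  by rewrite powRB ?tn0 ?implybT// powRr1// ltW.
by rewrite /epsilon /cst /GRing.scale/=; field; rewrite tn0 td.
Qed.

Lemma cvg_powR_pinfty (a : R) : 0 < a -> t `^ a @[t --> +oo] --> +oo.
Proof.
move=> a0; apply/cvgryPge => A; near=> t.
have A0 : 0 <= Num.max A 0 by rewrite le_max lexx orbT.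
have tA : Num.max A 0 `^ a^-1 <= t by near: t; exact: nbhs_pinfty_ge.
apply: (@le_trans _ _ (Num.max A 0)); first by rewrite le_max lexx.
rewrite -[leLHS]powRr1// -(mulVf (lt0r_neq0 a0)) powRrM.
by apply: ge0_ler_powR => //; rewrite ?nnegrE ?powR_ge0// ?ltW// (le_trans _ tA)// powR_ge0.
Unshelve. all: by end_near. Qed.

Lemma cvg_epsilon (c delta : R) : 0 < delta ->
  epsilon c delta t @[t --> +oo] --> (0 : R).
Proof.
move=> d0; rewrite -(mulr0 c); apply: cvgM; first exact: cvg_cst.
by apply/gtr0_cvgV0; [near=> t; rewrite powR_gt0//; near: t; exact: nbhs_pinfty_gt|exact: cvg_powR_pinfty].
Unshelve. all: by end_near. Qed.

End RealFunctions.

Section Velocity.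
Context {R : realType} {H : completeNormedModType R}.
Context (dot : {dot H for idfun}) (dot_norm : induces_norm dot).
Context (V gradh : H -> H) (e : R -> R) (x : R -> H).
Context (V_mono : monotone_operator dot V)
  (gradh_mono : monotone_operator dot gradh).

(** Split the increment of the residual into an increment of the monotone
    operator frozen at time [s], whose pairing with the increment of [x] is
    nonnegative, and the increment of the weight times [gradh (x t)]. *)
Lemma velocity_le (t : R) dx dF de : (\forall s \near t, 0 <= e s) ->
  is_derive t (1 : R) x dx ->
  is_derive t (1 : R) (fun s => Phi V gradh e s (x s)) dF ->
  is_derive t (1 : R) e de ->
  de * dot (gradh (x t)) dx <= dot dx dF.
Proof.
move=> e0 /is_derive_dnbhs xd /is_derive_dnbhs Fd /is_derive_dnbhs ed.
have lhs : dot ((s - t)^-1 *: (e s - e t) *: gradh (x t))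
    ((s - t)^-1 *: (x s - x t)) @[s --> t^'] --> dot (de *: gradh (x t)) dx.
  apply: cvg_dot => //; apply: cvgZ => //; exact: cvg_cst.
rewrite -dotZl; apply: (ler_cvg_to lhs (cvg_dot dot_norm xd Fd)).
have e0' : \forall s \near t^', 0 <= e s by exact: cvg_within e0.
apply: filterS e0' => s e0s; rewrite -subr_ge0.
have -> : Phi V gradh e s (x s) - Phi V gradh e t (x t) =
  (V (x s) - V (x t)) + e s *: (gradh (x s) - gradh (x t)) +
  (e s - e t) *: gradh (x t).
  rewrite /Phi scalerBr scalerBl opprD addrACA -[RHS]addrA.
  by rewrite [X in _ = _ + X]addrA addrNK.
have := V_mono (x s) (x t); have := gradh_mono (x s) (x t).
move: (x s - x t) (V (x s) - V (x t)) (gradh (x s) - gradh (x t)).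
move=> dx' dV dg dg0 dV0.
rewrite [X in 0 <= X](_ : _ = (s - t)^-1 ^+ 2 *
  (dot dV dx' + e s * dot dg dx')); last first.
  by rewrite !dotE !(dotC dot dx') /GRing.scale/=; ring.
by rewrite mulr_ge0 ?sqr_ge0// addr_ge0// mulr_ge0.
Qed.

End Velocity.

(** * Lyapunov analysis of a trajectory *)

Section Energy.
Context {R : realType} {H : completeNormedModType R}.
Context (dot : {dot H for idfun}) (h : H -> R) (gradh V : H -> H).
Context (c delta t1 : R) (x : R -> H).
Context (dot_norm : induces_norm dot)
  (h_convex : convex_function [set: convex_lmodType H] h)
  (h_grad : is_gradient dot h gradh)
  (h_lb : has_lbound (range h))
  (gradh_bounded : forall B : set H, bounded_set B -> bounded_set (gradh @` B))
  (V_mono : monotone_operator dot V)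
  (c_gt0 : 0 < c) (delta_gt0 : 0 < delta) (t1_gt0 : 0 < t1).

Let eps := epsilon c delta.
Let F t := Phi V gradh eps t (x t).

Context (trajectory : forall t, t1 < t -> exists dx dF,
  [/\ is_derive t (1 : R) x dx, is_derive t (1 : R) F dF & dx + dF + F t = 0]).

(** The Lyapunov analysis consumes an upper bound [k], with a bounded primitive
    [K], on the part of [dot (x t - xs) (F t)] that may be negative. The
    Attouch--Czarnecki-type and the sharpness conditions enter the energy
    estimates only through this property. *)
Definition dominated xs := exists (k K : R -> R) (B : R), forall t, t1 < t ->
  [/\ is_derive t (1 : R) K (k t), 0 <= k t, `|K t| <= B &
      - (eps t * dot (gradh xs) (x t - xs)) - dot (x t - xs) (V (x t)) <= k t].

(** Squared distance of [z t = x t + F t] to [xs], where [z' = - F]. *)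
Definition energy xs t := dot (x t + F t - xs) (x t + F t - xs).

Let t_gt0 t : t1 < t -> 0 < t. Proof. exact: lt_trans. Qed.
Let eps_gt0 t : t1 < t -> 0 < eps t.
Proof. by move=> /t_gt0; exact: epsilon_gt0. Qed.

Lemma is_derive_energy xs t : t1 < t ->
  is_derive t (1 : R) (energy xs) (- 2 * (dot (x t - xs) (F t) + dot (F t) (F t))).
Proof.
move=> t1t; have [dx [dF [xd Fd E]]] := trajectory t1t.
have zd : is_derive t (1 : R) (fun s => x s + F s - xs) (- F t).
  have := is_deriveB (is_deriveD xd Fd) (is_derive_cst xs t 1).
  by move=> /is_derive_eq; apply; rewrite subr0; apply/eqP; rewrite -addr_eq0 E.
have := is_derive_dot dot_norm zd zd; move=> /is_derive_eq; apply.
move: (F t) => f.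
by rewrite !dotE (dotC dot f (x t)) (dotC dot f xs); ring.
Qed.

Lemma dot_residual_ge xs t : t1 < t ->
  dot (x t - xs) (V (x t)) + eps t * dot (gradh xs) (x t - xs) <=
  dot (x t - xs) (F t).
Proof.
move=> t1t; rewrite /F /Phi [X in _ <= X]dotDr dotZr lerD2l ler_pM2l ?eps_gt0//.
have := gradient_monotone h_convex h_grad (x t) xs.
by rewrite dotDl dotNl subr_ge0 (dotC dot (x t - xs)).
Qed.

Section Dominated.
Context (xs : H) (k K : R -> R) (B : R).
Context (xs_zer : zer V xs).
Context (dom : forall t, t1 < t ->
  [/\ is_derive t (1 : R) K (k t), 0 <= k t, `|K t| <= B &
      - (eps t * dot (gradh xs) (x t - xs)) - dot (x t - xs) (V (x t)) <= k t]).

(** The primitive [K] compensates the part of the derivative of the energy that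
    may be positive, so [L] decreases at least as fast as [2 |F| ^ 2]. *)
Let L t := energy xs t - 2 * K t.

Let dL t := - 2 * (dot (x t - xs) (F t) + dot (F t) (F t)) - 2 * k t.

Let is_derive_L t : t1 < t -> is_derive t (1 : R) L (dL t).
Proof.
move=> t1t; have [Kd _ _ _] := dom t1t.
have := is_derive_add (is_derive_energy xs t1t)
  (is_derive_mul (is_derive_cst (- 2 : R) t 1) Kd).
rewrite mul0r add0r /cst => /is_derive_eq.
rewrite (_ : (fun s => _) = L); first by apply; rewrite /dL; ring.
by apply/funext => s; rewrite /L; ring.
Qed.

Let dL_le t : t1 < t -> dL t <= - 2 * dot (F t) (F t).
Proof.
move=> t1t; have [_ _ _ kt] := dom t1t; have := dot_residual_ge xs t1t.
by rewrite /dL; lra.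
Qed.

Let L_nonincreasing s t : t1 < s -> s <= t -> L t <= L s.
Proof.
apply: nonincreasing_of_derive => r t1r; exists (dL r); first exact: is_derive_L.
by rewrite (le_trans (dL_le t1r))// nmulr_rle0 ?dot_ge0// oppr_lt0.
Qed.

Let L_ge t : t1 < t -> - (2 * B) <= L t.
Proof.
move=> t1t; have [_ _ KB _] := dom t1t; have := dot_ge0 dot (x t + F t - xs).
by rewrite /L /energy; have := ler_norm (K t); lra.
Qed.

Let L_cvg : exists l : R, L t @[t --> +oo] --> l.
Proof. exact: nonincreasing_bounded_cvg L_nonincreasing L_ge. Qed.

Lemma energy_cvg : exists l : R, energy xs t @[t --> +oo] --> l.
Proof.
have [l Ll] := L_cvg.
have [m Km] : exists m : R, (- K t) @[t --> +oo] --> m.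
  apply: (@nonincreasing_bounded_cvg _ _ t1 (- B)).
    apply: nonincreasing_of_derive => t t1t; have [Kd k0 _ _] := dom t1t.
    by exists (- k t); [exact: is_deriveN|rewrite oppr_le0].
  by move=> t t1t; have [_ _ KB _] := dom t1t; rewrite lerN2 (le_trans (ler_norm _)).
exists (l - 2 * m); rewrite (_ : energy xs = fun t => L t - 2 * - K t).
  by apply: cvgB => //; apply: cvgM => //; exact: cvg_cst.
by apply/funext => t; rewrite /L; ring.
Qed.

(** The energy dominates [|x t - xs| ^ 2] up to a term that is linear in
    [|x t - xs|], so a bound on the energy bounds [x]. *)
Lemma trajectory_bounded : exists M : R, forall t : R, t1 + 1 <= t -> `|x t| <= M.
Proof.
pose A := L (t1 + 1) + 2 * B; pose p := `|gradh xs|.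
exists (`|xs| + (A + 2 * eps (t1 + 1) * p + 1)) => t t1t.
have t1t' : t1 < t by rewrite (lt_le_trans _ t1t)// ltrDl.
have t1t1 : t1 < t1 + 1 by rewrite ltrDl.
have epsle : eps t <= eps (t1 + 1).
  rewrite /eps /epsilon ler_pM2l// lef_pV2 ?posrE ?powR_gt0 ?t_gt0//.
  by apply: ge0_ler_powR => //; rewrite ?nnegrE ltW// t_gt0.
have et := eps_gt0 t1t'.
have [_ _ KB _] := dom t1t'.
have aV : 0 <= dot (x t - xs) (V (x t)).
  by rewrite dotC (zer_dot_ge0 V_mono).
have enA : energy xs t <= A.
  have := L_nonincreasing t1t1 t1t; rewrite {1}/L /A.
  by have := ler_norm (K t); lra.
have res := dot_residual_ge xs t1t'.
have enE : energy xs t = `|x t - xs| ^+ 2 + 2 * dot (x t - xs) (F t) + dot (F t) (F t).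
  rewrite /energy -(dot_sqr dot_norm); move: (F t) => f.
  by rewrite !dotE (dotC dot f (x t)) (dotC dot f xs) (dotC dot xs (x t)); ring.
have F0 := dot_ge0 dot (F t).
have gr : - (p * `|x t - xs|) <= dot (gradh xs) (x t - xs).
  by have := normr_dot dot_norm (gradh xs) (x t - xs); rewrite ler_norml => /andP[].
have -> : x t = xs + (x t - xs) by rewrite addrCA subrr addr0.
rewrite (le_trans (ler_normD _ _))// lerD2l.
set r := `|x t - xs| in enE gr *; have r0 : 0 <= r by exact: normr_ge0.
have p0 : 0 <= p by exact: normr_ge0.
have epr : eps t * (p * r) <= eps (t1 + 1) * p * r.
  by rewrite -mulrA ler_wpM2r// mulr_ge0.
have egr : - (eps t * (p * r)) <= eps t * dot (gradh xs) (x t - xs).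
  by rewrite -mulrN ler_pM2l.
have A0 : 0 <= A by rewrite (le_trans _ enA)// /energy dot_ge0.
set b := 2 * eps (t1 + 1) * p.
have e1 : 0 < eps (t1 + 1) by exact: eps_gt0.
have b0 : 0 <= b by apply: mulr_ge0 => //; apply: mulr_ge0 => //; exact: ltW.
have rr : r ^+ 2 <= A + b * r by rewrite /b; lra.
(* r > A + b + 1 would give r ^ 2 > A + b r, as r > 1 *)
by rewrite leNgt; apply/negP => rbig; nra.
Qed.

Lemma objective_bounded : exists M : R, forall t : R, t1 + 1 <= t -> `|h (x t)| <= M.
Proof.
have [M xM] := trajectory_bounded.
have [m hm] := h_lb.
have [g gM] : exists g : R, forall t, t1 + 1 <= t -> `|gradh (x t)| <= g.
  have /gradh_bounded : bounded_set [set y : H | `|y| <= M].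
    exists M; split; [exact: num_real|].
    by move=> N MN y /= /le_trans; apply; exact: ltW.
  move=> [N [_ /(_ (N + 1))]] gN; exists (N + 1) => t t1t.
  by apply: gN; rewrite ?ltrDl//; exists (x t) => //=; exact: xM.
exists (`|m| + `|h xs| + g * (M + `|xs|)) => t t1t.
have M0 : 0 <= M + `|xs| by rewrite addr_ge0// (le_trans _ (xM t t1t)).
have g0 : 0 <= g by rewrite (le_trans _ (gM t t1t)).
have gM0 : 0 <= g * (M + `|xs|) by rewrite mulr_ge0.
have hmt : m <= h (x t) by apply: hm; exists (x t).
have := gradient_le h_convex h_grad (x t) xs.
have : dot (gradh (x t)) (x t - xs) <= g * (M + `|xs|).
  rewrite (le_trans (dot_le dot_norm _ _))// ler_pM// ?gM//.
  by rewrite (le_trans (ler_normB _ _))// lerD2r xM.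
rewrite !dotE ler_norml => A1 A2.
have := ler_norm (h xs); have := ler_norm (- m); rewrite normrN.
have := normr_ge0 (h xs); have := normr_ge0 m.
by move=> *; apply/andP; split; lra.
Qed.

(** The middle term of [W] integrates the error [2 delta eps / t * (h o x)'] by
    parts; its bounded factor is nonnegative, so its own decay only helps.
    [W] and [L] converge and the middle term vanishes, hence [t |F t| ^ 2] has a
    limit [g]. If [g] were positive, [L + g ln] would eventually be
    nonincreasing although [L] is bounded below. *)
Lemma residual_cvg : t * dot (F t) (F t) @[t --> +oo] --> 0.
Proof.
have [B' hB'] := objective_bounded.
pose W t := t * dot (F t) (F t) + (2 * delta) * eps t * (B' - h (x t)) + L t.
have t1a t : t1 + 1 < t -> t1 < t by apply: lt_trans; rewrite ltrDl.
have W_noninc s t : t1 + 1 < s -> s <= t -> W t <= W s.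
  apply: nonincreasing_of_derive => r t1r.
  have r1 := t1a _ t1r; have r0 := t_gt0 r1.
  have [dx [dF [xd Fd E]]] := trajectory r1.
  have ed := is_derive_epsilon c delta r0.
  have hd := is_derive_gradient h_grad xd.
  have Gd := is_derive_dot dot_norm Fd Fd.
  have vel : - (delta * eps r / r) * dot (gradh (x r)) dx <= dot dx dF.
    apply: (velocity_le dot_norm V_mono (gradient_monotone h_convex h_grad) _ xd Fd ed).
    apply: filterS (lt_nbhsr r0) => s' s'0; apply: ltW; exact: epsilon_gt0.
  have Wd := is_derive_add (is_derive_add
      (is_derive_mul (is_derive_id r 1) Gd)
      (is_derive_mul (is_derive_mul (is_derive_cst (2 * delta) r 1) ed)
        (is_derive_add (is_derive_cst B' r 1) (is_deriveN hd))))
    (is_derive_L r1).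
  eexists; first exact: Wd.
  have hB : h (x r) <= B' by rewrite (le_trans (ler_norm _))// hB'// ltW.
  have FdF : dot (F r) dF = - dot dx dF - dot dF dF.
    move/eqP: E; rewrite addrC addr_eq0 => /eqP ->.
    by rewrite dotNl dotDl opprD.
  have vel' : - (delta * eps r) * dot (gradh (x r)) dx <= r * dot dx dF.
    by rewrite -(ler_pM2l r0) in vel; apply: le_trans vel; rewrite le_eqVlt;
      apply/orP; left; apply/eqP; field; rewrite gt_eqF.
  have q0 : 0 <= delta * (eps r / r) * (B' - h (x r)).
    apply: mulr_ge0; last by rewrite subr_ge0.
    by apply: mulr_ge0; [exact: ltW|apply: divr_ge0; apply: ltW => //; exact: eps_gt0].
  have dq0 : 0 <= delta * (delta * (eps r / r) * (B' - h (x r))).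
    by apply: mulr_ge0 => //; exact: ltW.
  have rdF : 0 <= r * dot dF dF by apply: mulr_ge0; [exact: ltW|exact: dot_ge0].
  have F0 := dot_ge0 dot (F r).
  have := dL_le r1; rewrite (dotC dot dF) FdF /cst -/eps.
  rewrite [(- (h \o x)) r](_ : _ = - h (x r))//.
  rewrite -(mulrA delta (eps r)).
  move: (dL r) (dot (F r) (F r)) (dot dF dF) (dot dx dF) F0 rdF vel' dq0.
  move: (eps r / r) => q dLr G dF2 dxF; lra.
have [w Ww] : exists w : R, W t @[t --> +oo] --> w.
  apply: (@nonincreasing_bounded_cvg _ _ _ (- (2 * B)) W_noninc) => t t1t.
  have := L_ge (t1a _ t1t); rewrite /W.
  have : 0 <= t * dot (F t) (F t).
    by apply: mulr_ge0; [exact/ltW/t_gt0/t1a|exact: dot_ge0].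
  have : 0 <= 2 * delta * eps t * (B' - h (x t)).
    apply: mulr_ge0; last by rewrite subr_ge0 (le_trans (ler_norm _))// hB'// ltW.
    by apply: mulr_ge0; [apply: mulr_ge0 => //; exact: ltW|exact/ltW/eps_gt0/t1a].
  by move=> *; lra.
have [l Ll] := L_cvg.
have epsh : 2 * delta * eps t * (B' - h (x t)) @[t --> +oo] --> 0.
  have eps0 : 2 * delta * eps t * (B' + B') @[t --> +oo] --> 0.
    rewrite -(mul0r (B' + B')); apply: cvgM; last exact: cvg_cst.
    by rewrite -(mulr0 (2 * delta)); apply: cvgM; [exact: cvg_cst|exact: cvg_epsilon].
  apply: squeeze_cvgr eps0; last exact: cvg_cst.
  near=> t; have t1t : t1 + 1 < t.
    by near: t; exact: (nbhs_pinfty_gt (num_real _)).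
  have := hB' t (ltW t1t); rewrite ler_norml => /andP[hl hu].
  have e0 : 0 <= 2 * delta * eps t.
    by apply: mulr_ge0; [apply: mulr_ge0 => //; exact: ltW|exact/ltW/eps_gt0/t1a].
  apply/andP; split; first by apply: mulr_ge0 => //; rewrite subr_ge0.
  by apply: ler_wpM2l => //; lra.
have Gl : t * dot (F t) (F t) @[t --> +oo] --> w - 0 - l.
  have -> : (fun t => t * dot (F t) (F t)) =
      (fun t => W t - 2 * delta * eps t * (B' - h (x t)) - L t).
    by apply/funext => t; rewrite /W; ring.
  by apply: cvgB => //; exact: cvgB.
suff l0 : w - 0 - l = 0 by rewrite -l0.
apply/eqP; rewrite eq_le; apply/andP; split; last first.
  apply: (cvgr_to_ge Gl); near=> t.
  have t1t : t1 + 1 < t by near: t; exact: (nbhs_pinfty_gt (num_real _)).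
  by apply: mulr_ge0; [exact/ltW/t_gt0/t1a|exact: dot_ge0].
rewrite leNgt; apply/negP; move: (w - 0 - l) Gl => g Gl g0.
have g2 : g / 2 < g by lra.
have [T [_ TG]] : \forall t \near +oo, g / 2 <= t * dot (F t) (F t).
  exact: (cvgr_ge _ Gl).
pose a := Num.max T t1.
have aT : T <= a by rewrite le_max lexx.
have at1 : t1 <= a by rewrite le_max lexx orbT.
have Lln s t : a < s -> s <= t -> L t + g * ln t <= L s + g * ln s.
  apply: (@nonincreasing_of_derive _ (fun t => L t + g * ln t)) => r ar.
  have r1 : t1 < r := le_lt_trans at1 ar.
  have r0 := t_gt0 r1.
  eexists.
    exact: (is_derive_add (is_derive_L r1)
      (is_derive_mul (is_derive_cst g r 1) (is_derive1_ln r0))).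
  have Gr : g * r^-1 <= 2 * dot (F r) (F r).
    by rewrite ler_pdivrMr//; have := TG r (le_lt_trans aT ar); lra.
  by have := dL_le r1; rewrite /cst mul0r add0r; lra.
(* at a time t with ln t >= C, the decrease of L + g ln pushes L below - 2 B *)
pose C := (L (a + 1) + g * ln (a + 1) + 2 * B + 1) / g.
pose t := Num.max (a + 1) (expR C).
have at1' : a + 1 <= t by rewrite le_max lexx.
have aa1 : a < a + 1 by rewrite ltrDl.
have := Lln _ _ aa1 at1'.
have := L_ge (lt_le_trans (le_lt_trans at1 aa1) at1').
have Ct : C <= ln t.
  have t_pos : 0 < t by rewrite lt_max expR_gt0 orbT.
  by rewrite -[C]expRK ler_ln ?posrE ?expR_gt0// le_max lexx orbT.
rewrite -(ler_pM2l g0) /C mulrC divfK ?gt_eqF// in Ct; lra.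
Unshelve. all: by end_near. Qed.

End Dominated.

End Energy.

(** * The Attouch--Czarnecki-type condition *)

(** No measurability of [phi] is available, but [k] is continuous and the
    integral of a nonnegative function is a supremum over the simple functions
    below it, hence monotone without further assumption. *)
Lemma bounded_primitive (R : realType) (k : R -> R) (phi : R -> \bar R)
    (t0 t1 : R) : t0 < t1 ->
  (forall t, t0 <= t -> 0 <= k t /\ ((k t)%:E <= phi t)%E) ->
  (forall t, t0 < t -> {for t, continuous k}) ->
  (\int[lebesgue_measure]_(t in `[t0, +oo[) phi t < +oo)%E ->
  exists (K : R -> R) (B : R), forall t, t1 < t ->
    is_derive t (1 : R) K (k t) /\ `|K t| <= B.
Proof.
move=> t01 kphi kc intphi.
pose mu := @lebesgue_measure R.
pose K (y : R) := (\int[mu]_(t in [set` `[t1, y]]) (k t))%R.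
have phi0 t : t \in (`[t0, +oo[%classic : set R) -> (0 <= phi t)%E.
  rewrite inE/= in_itv/= andbT => /kphi[k0 kp].
  by apply: le_trans kp; rewrite lee_fin.
have I0 : (0 <= \int[mu]_(t in `[t0, +oo[) phi t)%E.
  by apply: integral_ge0 => t ?; apply: phi0; rewrite inE.
have kint u : mu.-integrable `[t1, u] (EFin \o k).
  apply: continuous_compact_integrable; first exact: segment_compact.
  apply: continuous_in_subspaceT => t /[!inE]/= /[!in_itv]/= /andP[t1t _].
  by apply: kc; exact: lt_le_trans t1t.
exists K, (fine (\int[mu]_(t in `[t0, +oo[) phi t))%E => t t1t; split.
  have [dK KE] := @continuous_FTC1_closed R k t1 t (t + 1) (ltr_pwDr ltr01 (lexx t))
    (kint _) t1t (kc _ (lt_trans t01 t1t)).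
  by split; [exact: dK|rewrite -KE derive1E].
have k0 s : `[t1, t]%classic s -> (0 <= (k s)%:E)%E.
  rewrite /= in_itv/= => /andP[t1s _]; rewrite lee_fin.
  by have [] := kphi s (ltW (lt_le_trans t01 t1s)).
have K0 : 0 <= K t.
  by apply: fine_ge0; exact: integral_ge0.
rewrite ger0_norm// /K /Rintegral; apply: fine_le.
- exact: integrable_fin_num.
- by rewrite fin_numE; apply/andP; split; [rewrite gt_eqF// (lt_le_trans _ I0)|rewrite lt_eqF].
rewrite !ge0_integralE//; last by move=> s ?; apply: phi0; rewrite inE.
apply: ge_ereal_sup => _ [g gk <-]; apply: ereal_sup_ubound; exists g => // s.
apply: le_trans (gk s) _; rewrite /patch.
case: ifPn => [|_].
  rewrite inE/= in_itv/= => /andP[t1s _].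
  have t0s : t0 <= s by exact: ltW (lt_le_trans t01 t1s).
  by rewrite ifT ?inE/= ?in_itv/= ?andbT//; case: (kphi s t0s).
by case: ifPn => // /phi0.
Qed.

Section Domination.
Context {R : realType} {H : completeNormedModType R}.
Context (dot : {dot H for idfun}) (h : H -> R) (gradh V : H -> H).
Context (dot_norm : induces_norm dot) (h_grad : is_gradient dot h gradh)
  (V_cont : continuous V) (V_mono : monotone_operator dot V).

(** First-order optimality along the segments of the convex set [zer V]. *)
Lemma gradient_normal_cone xs : optimal_solution h V xs ->
  normal_cone dot (zer V) xs (- gradh xs).
Proof.
move=> [xsV xs_opt] y yV; rewrite dotNl oppr_le0.
apply: (cvgr_to_ge (gradient_direction (u := xs) (v := y - xs) h_grad)).
near=> s.
have s0 : 0 < s by near: s; exact: nbhs_right_gt.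
have s1 : s < 1 by near: s; exact: nbhs_right_lt.
rewrite mulr_ge0 ?invr_ge0 ?(ltW s0)// subr_ge0 xs_opt//.
by apply: (zer_convex dot_norm V_cont V_mono) => //; rewrite !ltW.
Unshelve. all: by end_near. Qed.

Lemma support_function_normal A xs p (e : R) : A xs -> normal_cone dot A xs p ->
  0 <= e -> support_function dot A (e *: p) = (dot xs (e *: p))%:E.
Proof.
move=> Axs Np e0; apply/eqP; rewrite eq_le; apply/andP; split.
  apply: ge_ereal_sup => _ [y Ay <-]; rewrite lee_fin -subr_ge0 !dotZr -mulrBr.
  have := Np y Ay; rewrite dotDr dotNr (dotC dot y) (dotC dot xs) => h0.
  by rewrite mulr_ge0//; lra.
by apply: ereal_sup_ubound; exists xs.
Qed.

(** Test the supremum defining the Fitzpatrick function at [y]; the support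
    function is attained at [xs]. *)
Lemma fitzpatrick_gap_ge xs p (e : R) (y : H) : zer V xs ->
  normal_cone dot (zer V) xs p -> 0 <= e ->
  ((e * dot p (y - xs) - dot (y - xs) (V y))%:E <=
   fitzpatrick dot V xs (e *: p) - support_function dot (zer V) (e *: p))%E.
Proof.
move=> xsV Np e0; rewrite (support_function_normal xsV Np e0).
rewrite leeBrDr// -EFinD; apply: ereal_sup_ubound; exists y => //.
by congr EFin; rewrite !dotE (dotC dot p y) (dotC dot p xs); ring.
Qed.

(** The positive part of the quantity to dominate is continuous and lies below
    the integrand of the condition. *)
Lemma attouch_czarnecki_dominated (c delta t0 t1 : R) (x : R -> H) xs :
  0 < c -> 0 < t0 -> t0 < t1 ->
  (forall t, t0 < t -> {for t, continuous x}) ->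
  optimal_solution h V xs ->
  attouch_czarnecki dot h V (epsilon c delta) t0 ->
  dominated dot gradh V c delta t1 x xs.
Proof.
move=> c0 t00 t01 xc xs_opt AC.
have Np := gradient_normal_cone xs_opt.
pose r t := epsilon c delta t * dot (- gradh xs) (x t - xs) - dot (x t - xs) (V (x t)).
have [||K [B KB]] := @bounded_primitive R (fun t => Num.max 0 (r t)) _ t0 t1 t01 _ _ (AC xs _ xs_opt Np).
- move=> t t0t; rewrite le_max lexx; split=> //.
  have e0 : 0 <= epsilon c delta t by apply/ltW/epsilon_gt0 => //; exact: lt_le_trans t0t.
  have := fitzpatrick_gap_ge (x t) xs_opt.1 Np e0.
  have := fitzpatrick_gap_ge xs xs_opt.1 Np e0.
  rewrite subrr dot0l dot0r mulr0 subrr => g0 gr.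
  by rewrite EFin_max ge_max g0 gr.
- move=> t t0t; have xt := xc t t0t.
  have xb : x s - xs @[s --> t] --> x t - xs by apply: cvgB => //; exact: cvg_cst.
  apply: continuous_max; first exact: cvg_cst.
  apply: cvgB.
    apply: cvgM; last by apply: cvg_dot => //; exact: cvg_cst.
    by apply: is_derive_continuous; apply: is_derive_epsilon; exact: lt_trans t0t.
  by apply: cvg_dot => //; apply: continuous_cvg => //; exact: V_cont.
exists (fun t => Num.max 0 (r t)), K, B => t t1t; have [Kd KBt] := KB t t1t.
split=> //; first by rewrite le_max lexx.
by rewrite le_max /r dotNl mulrN lexx orbT.
Qed.

End Domination.

(** * The sharpness condition *)

Section Sharpness.
Context {R : realType} {H : completeNormedModType R}.
Context (dot : {dot H for idfun}) (h : H -> R) (gradh V : H -> H).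
Context (dot_norm : induces_norm dot) (h_grad : is_gradient dot h gradh)
  (V_cont : continuous V) (V_mono : monotone_operator dot V).

(** For a normal vector [p] and [q] in [A], [dot p (y - xs)] is at most
    [dot p (y - q)]; then take the infimum over [q]. *)
Lemma normal_cone_le_dist (A : set H) xs p y : A xs -> normal_cone dot A xs p ->
  dot p (y - xs) <= `|p| * dist y A.
Proof.
move=> Axs Np.
have le_p q : A q -> dot p (y - xs) <= `|p| * `|y - q|.
  move=> Aq; apply: le_trans (dot_le dot_norm _ _).
  by have := Np q Aq; rewrite !dotDr !dotNr; lra.
have [p0|p0] := eqVneq p 0; first by rewrite p0 dot0l normr0 mul0r.
rewrite mulrC -ler_pdivrMr ?normr_gt0//; apply: lb_le_inf; first by exists `|y - xs|, xs.
by move=> _ [q Aq <-]; rewrite ler_pdivrMr ?normr_gt0// mulrC le_p.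
Qed.

(** Young's inequality for the product of [tau ^ (1 / rho) d] and
    [l / tau ^ (1 / rho)]. *)
Lemma young_sharpness (tau rho rho_star d l : R) : 0 < tau -> 0 < rho ->
  0 < rho_star -> rho^-1 + rho_star^-1 = 1 -> 0 <= d -> 0 <= l ->
  l * d - tau / rho * d `^ rho <= (l / tau `^ rho^-1) `^ rho_star / rho_star.
Proof.
move=> tau0 rho0 rhos0 conj d0 l0.
have tr0 : 0 < tau `^ rho^-1 by rewrite powR_gt0.
have lt0 : 0 <= l / tau `^ rho^-1 by rewrite divr_ge0// ltW.
have := conjugate_powR (mulr_ge0 (ltW tr0) d0) lt0 rho0 rhos0 conj.
rewrite (powRM _ (ltW tr0) d0) -powRrM mulVf ?gt_eqF// powRr1 ?(ltW tau0)//.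
rewrite (_ : _ * d * _ = l * d); last by field; rewrite gt_eqF.
by rewrite lerBlDr addrC (mulrAC tau).
Qed.

(** The factor 2 leaves half of the gap [dot (y - xs) (V y)] to spare: it is
    used to bound the weighted objective from below. *)
Lemma sharpness_bound (c delta rho rho_star : R) xs :
  0 < c -> 1 < rho -> rho^-1 + rho_star^-1 = 1 -> 0 < rho_star ->
  optimal_solution h V xs -> sharpness dot h V rho ->
  exists2 C : R, 0 <= C & forall t y, 0 < t ->
    2 * (- (epsilon c delta t * dot (gradh xs) (y - xs))) <=
    dot (y - xs) (V y) + C * t `^ (- (delta * rho_star)).
Proof.
move=> c0 rho1 conj rhos0 xs_opt sharp.
have [tau tau0 sh] := sharp xs xs_opt.
have rho0 : 0 < rho by exact: lt_trans rho1.
pose q := 2 * c * `|gradh xs| / tau `^ rho^-1.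
have q0 : 0 <= q by rewrite divr_ge0 ?powR_ge0// !mulr_ge0// ltW.
exists (q `^ rho_star / rho_star); first by rewrite divr_ge0 ?powR_ge0// ltW.
move=> t y t0.
have e0 := epsilon_gt0 delta c0 t0.
have := normal_cone_le_dist y xs_opt.1
  (gradient_normal_cone dot_norm h_grad V_cont V_mono xs_opt).
rewrite normrN dotNl => Nd.
have d0 : 0 <= dist y (zer V).
  by apply: lb_le_inf; [exists `|y - xs|, xs => //; exact: xs_opt.1|move=> _ [z _ <-]].
have l0 : 0 <= 2 * epsilon c delta t * `|gradh xs| by apply: mulr_ge0 => //; apply: mulr_ge0 => //; exact: ltW.
have := young_sharpness tau0 rho0 rhos0 conj d0 l0.
rewrite (_ : _ / tau `^ _ = q * t `^ (- delta)); last first.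
  by rewrite powRN /q /epsilon; ring.
rewrite powRM ?powR_ge0// -powRrM mulNr [X in _ <= X -> _]mulrAC => yo.
have := ler_wpM2l (ltW e0) Nd; have := sh y; lra.
Qed.

(** The dominating function is [C / t ^ s] with [s = delta rho_star] above 1,
    whose primitive is bounded. *)
Lemma sharpness_dominated (c delta rho rho_star t1 : R) (x : R -> H) xs :
  0 < c -> 1 < rho -> rho^-1 + rho_star^-1 = 1 -> 0 < rho_star -> 0 < t1 ->
  1 < delta * rho_star ->
  optimal_solution h V xs -> sharpness dot h V rho ->
  dominated dot gradh V c delta t1 x xs.
Proof.
move=> c0 rho1 conj rhos0 t10 s1 xs_opt sharp.
have [C C0 CP] := sharpness_bound delta c0 rho1 conj rhos0 xs_opt sharp.
set s := delta * rho_star in s1 CP.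
exists (fun t => C * t `^ (- s)), (fun t => C / (1 - s) * t `^ (1 - s)),
  (C / (s - 1) * t1 `^ (1 - s)) => t t1t.
have t0 : 0 < t by exact: lt_trans t1t.
have s0 : 1 - s != 0 by rewrite lt_eqF// subr_lt0.
have Cs0 : 0 <= C / (s - 1) by rewrite divr_ge0// subr_ge0 ltW.
have CP0 : 0 <= C * t `^ (- s) by rewrite mulr_ge0// powR_ge0.
split; [|exact: CP0| |].
- have := is_derive_mul (is_derive_cst (C / (1 - s)) t 1) (is_derive1_powR (1 - s) t0).
  move=> /is_derive_eq; apply; rewrite mul0r add0r /cst.
  rewrite (_ : 1 - s - 1 = - s); last by ring.
  by rewrite mulrA divfK.
- rewrite normrM (ger0_norm (powR_ge0 _ _)) (_ : `|C / (1 - s)| = C / (s - 1)).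
    rewrite ler_wpM2l// -(opprB s 1) !powRN lef_pV2 ?posrE ?powR_gt0//.
    by apply: ge0_ler_powR; rewrite ?nnegrE ?subr_ge0 ?(ltW s1) ?(ltW t0) ?(ltW t10) ?(ltW t1t).
  by rewrite -(opprB s 1) invrN mulrN normrN ger0_norm.
have aV : 0 <= dot (x t - xs) (V (x t)).
  by rewrite dotC (zer_dot_ge0 V_mono)//; exact: xs_opt.1.
have := CP t (x t) t0; lra.
Qed.

End Sharpness.

(** * Weak convergence *)

Section WeakConvergence.
Context {R : realType} {H : completeNormedModType R}.
Context (dot : {dot H for idfun}) (h : H -> R) (gradh V : H -> H).
Context (x : R -> H) (M : R).
Context (dot_norm : induces_norm dot)
  (h_convex : convex_function [set: convex_lmodType H] h)
  (h_grad : is_gradient dot h gradh)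
  (V_cont : continuous V) (V_mono : monotone_operator dot V)
  (x_bounded : \forall t \near +oo, `|x t| <= M)
  (Vx0 : V (x t) @[t --> +oo] --> (0 : H)).

(** Weak limits along ultrafilters are zeros of [V], and [h] is weakly lower
    semicontinuous because it lies above its tangents. *)
Lemma ultra_weak_limit_zer (U : set_system R) : UltraFilter U ->
  +oo_R `<=` U -> exists w, [/\ forall v, dot (x t) v @[t --> U] --> dot w v,
    zer V w & forall m : R, (\forall t \near U, h (x t) <= m) -> h w <= m].
Proof.
move=> UU PU; have UP : ProperFilter U by apply: ultra_proper.
have xM : \forall t \near U, `|x t| <= M by exact: PU.
have [w xw] := ultra_weak_limit dot_norm UU xM.
exists w; split=> //.
  by apply: (zer_weak_limit dot_norm V_cont V_mono UP xM xw) => A /Vx0; exact: PU.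
move=> m hm.
have lim : h w + (dot (x t) (gradh w) - dot w (gradh w)) @[t --> U] -->
    h w + (dot w (gradh w) - dot w (gradh w)).
  by apply: cvgD; [exact: cvg_cst|apply: cvgB => //; exact: cvg_cst].
rewrite subrr addr0 in lim.
apply: (cvgr_to_le lim); apply: filterS hm => t; apply: le_trans.
apply: le_trans (gradient_le h_convex h_grad w (x t)).
by rewrite dotDr dotNr !(dotC dot (gradh w)).
Qed.

Lemma objective_liminf xs (e : R) : optimal_solution h V xs -> 0 < e ->
  \forall t \near +oo, h xs - e <= h (x t).
Proof.
move=> [_ xs_opt] e0; apply: near_of_ultra => U UU PU.
have UP : ProperFilter U by apply: ultra_proper.
have [//|Uh] := in_ultra_setVsetC [set t | h xs - e <= h (x t)] UU.
have [w [_ wV hw]] := ultra_weak_limit_zer UU PU.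
have : h w <= h xs - e.
  by apply: hw; apply: filterS Uh => t /= /negP; rewrite -ltNge => /ltW.
by have := xs_opt w wV; lra.
Qed.

(** Two weak limits [w] and [w0] along different ultrafilters are both optimal.
    The difference of the squared distances of [z] to them is affine in [z] and
    converges, so [dot (x t) (w0 - w)] has one limit, equal to both
    [dot w (w0 - w)] and [dot w0 (w0 - w)]. *)
Lemma opial (z : R -> H) (xs : H) : optimal_solution h V xs ->
  h (x t) @[t --> +oo] --> h xs ->
  z t - x t @[t --> +oo] --> (0 : H) ->
  (forall w, optimal_solution h V w ->
    exists l : R, dot (z t - w) (z t - w) @[t --> +oo] --> l) ->
  exists2 xinf, optimal_solution h V xinf & weakly_converges_at_pinfty dot x xinf.
Proof.
move=> [xsV xs_opt] hx zx zw.
have weak U : UltraFilter U -> +oo_R `<=` U ->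
    exists2 w, optimal_solution h V w & forall v, dot (x t) v @[t --> U] --> dot w v.
  move=> UU PU; have UP : ProperFilter U by apply: ultra_proper.
  have [w [xw wV hw]] := ultra_weak_limit_zer UU PU.
  exists w => //; split=> // y /xs_opt; apply: le_trans.
  rewrite leNgt; apply/negP => hxs.
  have hm : h xs < (h xs + h w) / 2 by lra.
  have : h w <= (h xs + h w) / 2.
    by apply: hw; apply: PU; exact: (cvgr_le _ hx).
  by lra.
have [U0 [UU0 PU0]] := ultraFilterLemma (@proper_pinfty_nbhs R).
have [w0 w0_opt xw0] := weak U0 UU0 PU0.
exists w0 => // v; apply/cvgrPdist_lt => e e0; apply: near_of_ultra => U UU PU.
have UP : ProperFilter U by apply: ultra_proper.
have UP0 : ProperFilter U0 by apply: ultra_proper.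
have [w w_opt xw] := weak U UU PU.
suff -> : w0 = w by move/cvgrPdist_lt : (xw v); exact.
have [l zl] := zw w w_opt; have [l0 zl0] := zw w0 w0_opt.
(* the difference of the two squared distances is affine in z, so z has a limit
   against w0 - w along the whole half-line *)
have xd : dot (x t) (w0 - w) @[t --> +oo] -->
    (l - l0 + dot w0 w0 - dot w w) / 2 - 0.
  have -> : (fun t => dot (x t) (w0 - w)) = (fun t =>
      (dot (z t - w) (z t - w) - dot (z t - w0) (z t - w0) +
       dot w0 w0 - dot w w) / 2 - dot (z t - x t) (w0 - w)).
    apply/funext => t; rewrite !dotE (dotC dot w (z t)) (dotC dot w0 (z t)).
    by field.
  apply: cvgB; last by rewrite -(dot0l dot (w0 - w)); apply: cvg_dot => //; exact: cvg_cst.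
  apply: cvgM; last exact: cvg_cst.
  apply: cvgB; last exact: cvg_cst.
  by apply: cvgD; [exact: cvgB|exact: cvg_cst].
have E : dot w (w0 - w) = (l - l0 + dot w0 w0 - dot w w) / 2 - 0.
  by apply: (cvg_unique _ (xw (w0 - w))) => //; apply: cvg_trans xd; exact: cvg_app.
have E0 : dot w0 (w0 - w) = (l - l0 + dot w0 w0 - dot w w) / 2 - 0.
  by apply: (cvg_unique _ (xw0 (w0 - w))) => //; apply: cvg_trans xd; exact: cvg_app.
apply/eqP; rewrite -subr_eq0 -normr_eq0 -sqrf_eq0 -(dot_sqr dot_norm) {1}dotDl dotNl E E0.
by rewrite subrr.
Qed.

End WeakConvergence.

(** * Rates of convergence *)

Section Asymptotics.
Context {R : realType}.

Lemma near_powR_le (C r a b : R) : 0 < r -> a < b ->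
  \forall t \near +oo, C / t `^ b <= r / t `^ a.
Proof.
move=> r0 ab; have ba0 : 0 < b - a by rewrite subr_gt0.
have /cvgryPge /(_ (C / r)) := cvg_powR_pinfty ba0.
apply: filterS2 (nbhs_pinfty_gt (num_real 0)) => t t0 Ct.
have ta : 0 < t `^ a by rewrite powR_gt0.
have tb : 0 < t `^ b by rewrite powR_gt0.
rewrite ler_pdivrMr// mulrAC ler_pdivlMr//.
rewrite ler_pdivrMr// in Ct.
rewrite (_ : b = a + (b - a)); last by ring.
rewrite powRD ?(gt_eqF t0) ?implybT// mulrCA mulrC (mulrC r).
by rewrite ler_wpM2l// ltW.
Qed.

Lemma sqrt_powR (t : R) : 0 <= t -> Num.sqrt t = t `^ 2^-1.
Proof. by move=> t0; rewrite powR12_sqrt. Qed.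

Lemma littleo_near (f g : R -> R) :
  (forall r : R, 0 < r -> \forall t \near +oo, `|f t| <= r * g t) ->
  (f : R -> R^o) =o_ (+oo_R) (g : R -> R^o).
Proof.
move=> fg; apply/eqoP => r r0.
by apply: filterS (fg r r0) => t ft; rewrite (le_trans ft)// ler_wpM2l ?ler_norm// ltW.
Qed.

Lemma bigO_near (f g : R -> R) (k : R) :
  (\forall t \near +oo, `|f t| <= k * g t) -> 
  (f : R -> R^o) =O_ (+oo_R) (g : R -> R^o).
Proof.
move=> fg; apply/eqOP; near=> K.
apply: filterS fg => t ft; apply: (le_trans ft).
have kK : `|k| <= K by near: K; exact: (nbhs_pinfty_ge (num_real _)).
by rewrite (le_trans (ler_norm _))// normrM ler_wpM2r.
Unshelve. all: by end_near. Qed.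

End Asymptotics.

Section Rates.
Context {R : realType} {H : completeNormedModType R}.
Context (dot : {dot H for idfun}) (h : H -> R) (gradh V : H -> H).
Context (c delta t1 : R) (x : R -> H) (xs : H).
Context (dot_norm : induces_norm dot)
  (h_convex : convex_function [set: convex_lmodType H] h)
  (h_grad : is_gradient dot h gradh)
  (h_lb : has_lbound (range h))
  (gradh_bounded : forall B : set H, bounded_set B -> bounded_set (gradh @` B))
  (V_cont : continuous V) (V_mono : monotone_operator dot V)
  (c_gt0 : 0 < c) (delta_gt0 : 0 < delta) (t1_gt0 : 0 < t1).

Let eps := epsilon c delta.
Let F t := Phi V gradh eps t (x t).

Context (trajectory : forall t, t1 < t -> exists dx dF,
  [/\ is_derive t (1 : R) x dx, is_derive t (1 : R) F dF & dx + dF + F t = 0]).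
Context (xs_opt : optimal_solution h V xs)
  (dom : forall w, optimal_solution h V w -> dominated dot gradh V c delta t1 x w).

Lemma trajectory_near_bounded : exists M : R, \forall t \near +oo, `|x t| <= M.
Proof.
have [k [K [B domx]]] := dom xs_opt.
have [M xM] := trajectory_bounded dot_norm h_convex h_grad V_mono c_gt0
  delta_gt0 t1_gt0 trajectory xs_opt.1 domx.
by exists M; apply: filterS (nbhs_pinfty_ge (num_real (t1 + 1))) => t; exact: xM.
Qed.

Lemma residual_rate (r : R) : 0 < r -> \forall t \near +oo, `|F t| <= r / Num.sqrt t.
Proof.
move=> r0; have [k [K [B domx]]] := dom xs_opt.
have := residual_cvg dot_norm h_convex h_grad h_lb gradh_bounded V_mono c_gt0
  delta_gt0 t1_gt0 trajectory xs_opt.1 domx.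
move=> /cvgr0Pnorm_lt /(_ (r ^+ 2) (exprn_gt0 2 r0)).
apply: filterS2 (nbhs_pinfty_gt (num_real 0)) => t t0.
rewrite ger0_norm ?mulr_ge0 ?dot_ge0 ?(ltW t0)// (dot_sqr dot_norm) -/eps -/(F t) => tF.
have st : 0 < Num.sqrt t by rewrite sqrtr_gt0.
rewrite ler_pdivlMr// -ler_sqr ?nnegrE ?mulr_ge0 ?(ltW r0)//.
by rewrite exprMn sqr_sqrtr ?(ltW t0)// mulrC; exact: ltW.
Qed.

Lemma gradh_near : exists2 g : R, 0 <= g & \forall t \near +oo, `|gradh (x t)| <= g.
Proof.
have [M xM] := trajectory_near_bounded.
have /gradh_bounded : bounded_set [set y : H | `|y| <= M].
  by exists M; split; [exact: num_real|move=> N MN y /= /le_trans; apply; exact: ltW].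
move=> [N [_ /(_ (`|N| + 1))]] gN; exists (`|N| + 1); first by rewrite addr_ge0.
apply: filterS xM => t xM; apply: gN; last by exists (x t).
by rewrite (le_lt_trans (ler_norm N))// ltrDl.
Qed.

Lemma V_le_residual : exists2 g : R, 0 <= g &
  \forall t \near +oo, `|V (x t)| <= `|F t| + g / t `^ delta.
Proof.
have [g g0 gx] := gradh_near; exists (c * g); first by rewrite mulr_ge0// ltW.
apply: filterS2 (nbhs_pinfty_gt (num_real 0)) gx => t t0 gx.
have -> : V (x t) = F t - eps t *: gradh (x t) by rewrite /F /Phi addrK.
rewrite (le_trans (ler_normB _ _))// lerD2l normrZ.
have e0 : 0 < eps t := epsilon_gt0 delta c_gt0 t0.
by rewrite gtr0_norm// [leRHS]mulrAC ler_wpM2l// ltW.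
Qed.

(** The contribution of the gradient decays like [t ^ (- delta)], faster than
    [1 / sqrt t]. *)
Lemma V_littleo (r : R) : 2^-1 < delta -> 0 < r ->
  \forall t \near +oo, `|V (x t)| <= r / Num.sqrt t.
Proof.
move=> d2 r0; have [g _ Vg] := V_le_residual.
have r2 : 0 < r / 2 by rewrite divr_gt0.
apply: filterS3 Vg (residual_rate r2) (filterI (nbhs_pinfty_gt (num_real 0)) (near_powR_le g r2 d2)).
move=> t Vt Ft [t0 gt]; rewrite -sqrt_powR ?(ltW t0)// in gt.
have -> : r / Num.sqrt t = r / 2 / Num.sqrt t + r / 2 / Num.sqrt t by field; rewrite gt_eqF ?sqrtr_gt0.
exact: le_trans Vt (lerD Ft gt).
Qed.

Section SlowDecay.
Context (delta_le : delta <= 2^-1).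

Lemma sqrt_le_powR (t : R) : 1 <= t -> (Num.sqrt t)^-1 <= (t `^ delta)^-1.
Proof.
move=> t1t; have t0 : 0 < t by exact: lt_le_trans t1t.
rewrite sqrt_powR ?(ltW t0)// lef_pV2 ?posrE ?powR_gt0//.
exact: ler_powR.
Qed.

Lemma V_bigO : exists k : R, \forall t \near +oo, `|V (x t)| <= k / t `^ delta.
Proof.
have [g _ Vg] := V_le_residual; exists (1 + g).
apply: filterS3 Vg (residual_rate ltr01) (nbhs_pinfty_ge (num_real 1)) => t Vt Ft t1t.
rewrite (le_trans Vt)// mulrDl lerD2r (le_trans Ft)// !mul1r.
exact: sqrt_le_powR.
Qed.

Lemma V_cvg0 : V (x t) @[t --> +oo] --> (0 : H).
Proof.
have [k Vk] := V_bigO; apply/norm_cvg0P.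
apply: squeeze_cvgr (cvg_epsilon k delta_gt0); last exact: cvg_cst.
by apply: filterS Vk => t Vk; rewrite normr_ge0.
Qed.

(** With [delta = 1/2] the weight is exactly [c / sqrt t], so an asymptotic lower
    bound on [h (x t) - h xs] becomes one of order [1 / sqrt t]. *)
Lemma lower_bound_half (r : R) : delta = 2^-1 -> 0 < r -> \forall t \near +oo,
  - (r / Num.sqrt t) <= eps t * (h (x t) - h xs) + dot (x t - xs) (V (x t)) / 2.
Proof.
move=> delta2 r0; have [M xM] := trajectory_near_bounded.
apply: filterS2 (objective_liminf dot_norm h_convex h_grad V_cont V_mono xM V_cvg0
  xs_opt (divr_gt0 r0 c_gt0)) (nbhs_pinfty_gt (num_real 0)) => t ht t0.
have e0 : 0 < eps t := epsilon_gt0 delta c_gt0 t0.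
have -> : r / Num.sqrt t = eps t * (r / c).
  rewrite sqrt_powR ?(ltW t0)// /eps /epsilon delta2.
  by field; rewrite !gt_eqF ?powR_gt0.
have a0 : 0 <= dot (x t - xs) (V (x t)) / 2.
  by rewrite divr_ge0// dotC (zer_dot_ge0 V_mono)//; exact: xs_opt.1.
rewrite -mulrN ler_wpDr// ler_pM2l//; lra.
Qed.

(* The weighted objective may be negative; half of the nonnegative gap is allowed
   to compensate it, and the other half is what the upper bound then controls. *)
Context (lower : forall r : R, 0 < r -> \forall t \near +oo,
  - (r / Num.sqrt t) <= eps t * (h (x t) - h xs) + dot (x t - xs) (V (x t)) / 2).

(** By convexity of [h] the left-hand side is at most [dot (x t - xs) (F t)],
    and [x] is bounded. *)
Lemma residual_upper_bound (r : R) : 0 < r -> \forall t \near +oo,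
  dot (x t - xs) (V (x t)) + eps t * (h (x t) - h xs) <= r / Num.sqrt t.
Proof.
move=> r0; have [M xM] := trajectory_near_bounded.
have N0 : 0 < `|M| + `|xs| + 1 by rewrite ltr_wpDl// addr_ge0.
apply: filterS3 xM (residual_rate (divr_gt0 r0 N0)) (nbhs_pinfty_gt (num_real 0)).
move=> t xM Ft t0; have e0 : 0 < eps t := epsilon_gt0 delta c_gt0 t0.
apply: (@le_trans _ _ (dot (x t - xs) (F t))).
  rewrite /F /Phi [X in _ <= X]dotDr dotZr lerD2l ler_pM2l//.
  have := gradient_le h_convex h_grad (x t) xs.
  by rewrite (dotC dot (x t - xs)) !dotDr !dotNr; lra.
rewrite (le_trans (dot_le dot_norm _ _))//.
have xN : `|x t - xs| <= `|M| + `|xs| + 1.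
  by rewrite (le_trans (ler_normB _ _))//; have := ler_norm M; lra.
rewrite (le_trans (ler_pM _ _ xN Ft))//.
by rewrite mulrA mulrCA divff ?mulr1// gt_eqF.
Qed.

Let aV t : 0 <= dot (x t - xs) (V (x t)).
Proof. by rewrite dotC (zer_dot_ge0 V_mono)//; exact: xs_opt.1. Qed.

Lemma gap_littleo (r : R) : 0 < r -> \forall t \near +oo,
  `|dot (x t - xs) (V (x t))| <= r / Num.sqrt t.
Proof.
move=> r0; have r4 : 0 < r / 4 by rewrite divr_gt0.
apply: filterS2 (residual_upper_bound r4) (lower r4) => t; rewrite ger0_norm//.
rewrite (mulrAC r); lra.
Qed.

(** The gap is nonnegative, so the upper bound controls the objective from above
    and the lower bound, with the rate of the gap, from below. *)
Lemma objective_scaled_littleo (r : R) : 0 < r -> \forall t \near +oo,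
  eps t * `|h (x t) - h xs| <= r / Num.sqrt t.
Proof.
move=> r0; have r2 : 0 < r / 2 by rewrite divr_gt0.
apply: filterS3 (residual_upper_bound r2) (lower r2)
  (filterI (gap_littleo r2) (nbhs_pinfty_gt (num_real 0))).
move=> t up low [gap t0]; have e0 : 0 < eps t := epsilon_gt0 delta c_gt0 t0.
rewrite -(ger0_norm (ltW e0)) -normrM ler_norml.
have a0 := aV t; rewrite ger0_norm// in gap.
have s0 : 0 < (Num.sqrt t)^-1 by rewrite invr_gt0 sqrtr_gt0.
have rs := mulr_gt0 r0 s0.
by apply/andP; split; lra.
Qed.

Lemma objective_rate (r : R) : 0 < r -> \forall t \near +oo,
  `|h (x t) - h xs| <= r / t `^ (2^-1 - delta).
Proof.
move=> r0.
apply: filterS2 (objective_scaled_littleo (mulr_gt0 r0 c_gt0))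
  (nbhs_pinfty_gt (num_real 0)) => t + t0.
have e0 : 0 < eps t := epsilon_gt0 delta c_gt0 t0.
have td : 0 < t `^ delta by rewrite powR_gt0.
have ts : 0 < t `^ 2^-1 by rewrite powR_gt0.
rewrite sqrt_powR ?(ltW t0)// powRB ?(gt_eqF t0) ?implybT// mulrC -ler_pdivlMr//.
move=> /le_trans; apply; rewrite le_eqVlt; apply/orP; left; apply/eqP.
by rewrite /eps /epsilon; field; rewrite !gt_eqF.
Qed.

Lemma objective_cvg : h (x t) @[t --> +oo] --> h xs.
Proof.
apply/cvgrPdist_le => r r0.
apply: filterS2 (objective_rate r0) (nbhs_pinfty_ge (num_real 1)) => t + t1t.
rewrite distrC => /le_trans; apply.
rewrite ler_pdivrMr ?powR_gt0// ?(lt_le_trans ltr01)//.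
apply: ler_peMr; first exact: ltW.
by rewrite -[leLHS](powRr0 t) ler_powR// subr_ge0.
Qed.

Lemma weak_convergence : exists2 xinf, optimal_solution h V xinf &
  weakly_converges_at_pinfty dot x xinf.
Proof.
have [M xM] := trajectory_near_bounded.
apply: (opial dot_norm h_convex h_grad V_cont V_mono xM V_cvg0 (z := fun t => x t + F t) xs_opt objective_cvg).
  have -> : (fun t => x t + F t - x t) = F by apply/funext => t; rewrite addrAC subrr add0r.
  apply/norm_cvg0P.
  have d0 : 0 < 2^-1 :> R by [].
  apply: squeeze_cvgr (cvg_epsilon 1 d0); last exact: cvg_cst.
  apply: filterS2 (residual_rate ltr01) (nbhs_pinfty_ge (num_real 0)) => t Ft t0.
  by rewrite normr_ge0 /epsilon -sqrt_powR.
move=> w w_opt; have [k [K [B domw]]] := dom w_opt.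
exact: (energy_cvg dot_norm h_convex h_grad c_gt0 t1_gt0 trajectory domw).
Qed.

Lemma slow_decay_rates : [/\
  exists k : R, \forall t \near +oo, `|V (x t)| <= k / t `^ delta,
  forall r : R, 0 < r -> \forall t \near +oo,
    `|dot (x t - xs) (V (x t))| <= r / Num.sqrt t,
  forall r : R, 0 < r -> \forall t \near +oo,
    `|h (x t) - h xs| <= r / t `^ (2^-1 - delta),
  h (x t) @[t --> +oo] --> h xs &
  exists2 xinf, optimal_solution h V xinf & weakly_converges_at_pinfty dot x xinf].
Proof.
split; [exact: V_bigO|exact: gap_littleo|exact: objective_rate|
  exact: objective_cvg|exact: weak_convergence].
Qed.

End SlowDecay.
End Rates.

(** * The convergence theorem *)

Theorem theorem2p7 (R : realType) (H : completeNormedModType R)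
    (dot : {dot H for idfun}) (h : H -> R) (gradh V : H -> H)
    (c delta t0 : R) (x : R -> H) (xs : H) :
  induces_norm dot ->
  convex_function [set: convex_lmodType H] h ->
  is_gradient dot h gradh ->
  continuous gradh ->
  has_lbound (range h) ->
  (forall B : set H, bounded_set B -> bounded_set (gradh @` B)) ->
  continuous V ->
  monotone_operator dot V ->
  0 < c -> 0 < delta -> 0 < t0 ->
  solution_trajectory V gradh (epsilon c delta) t0 x ->
  optimal_solution h V xs ->
  [/\ attouch_czarnecki dot h V (epsilon c delta) t0 ->
      2^-1 < delta ->
      (fun t => `|V (x t)| : R^o) =o_ (+oo_R) (fun t => (Num.sqrt t)^-1 : R^o),

      attouch_czarnecki dot h V (epsilon c delta) t0 ->
      delta = 2^-1 ->
      [/\ (fun t => `|V (x t)| : R^o) =O_ (+oo_R) (fun t => (Num.sqrt t)^-1 : R^o),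
          (fun t => dot (x t - xs) (V (x t)) : R^o) =o_ (+oo_R) (fun t => (Num.sqrt t)^-1 : R^o),
          h (x t) @[t --> +oo_R] --> h xs &
          exists2 xinf, optimal_solution h V xinf &
            weakly_converges_at_pinfty dot x xinf] &

      forall rho rho_star : R, 1 < rho < 2 -> rho^-1 + rho_star^-1 = 1 ->
      sharpness dot h V rho ->
      rho_star^-1 < delta < 2^-1 ->
      [/\ (fun t => `|V (x t)| : R^o) =O_ (+oo_R) (fun t => (t `^ delta)^-1 : R^o),
          (fun t => dot (x t - xs) (V (x t)) : R^o) =o_ (+oo_R) (fun t => (Num.sqrt t)^-1 : R^o),
          (fun t => `|h (x t) - h xs| : R^o) =o_ (+oo_R) (fun t => (t `^ (2^-1 - delta))^-1 : R^o) &
          exists2 xinf, optimal_solution h V xinf &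
            weakly_converges_at_pinfty dot x xinf]].
Proof.
move=> dot_norm h_convex h_grad _ h_lb gradh_bounded V_cont V_mono
  c_gt0 delta_gt0 t0_gt0 sol xs_opt.
(* Only large times matter. After t0 the derivatives are two-sided, and from
   t0 + 1 on the dominating function is continuous up to the left endpoint. *)
have t01 : t0 < t0 + 1 by rewrite ltrDl.
have t1_gt0 : 0 < t0 + 1 by exact: lt_trans t01.
have trajectory0 t : t0 < t -> exists dx dF : H,
  [/\ is_derive t (1 : R) x dx,
      is_derive t (1 : R) (fun s => Phi V gradh (epsilon c delta) s (x s)) dF &
      dx + dF + Phi V gradh (epsilon c delta) t (x t) = 0].
  move=> t0t; have [dx [dF [xd Fd E]]] := sol t (ltW t0t).
  exists dx, dF; split=> //.
    exact: has_derivative_within_is_derive xd.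
  exact: has_derivative_within_is_derive Fd.
have trajectory t (t1t : t0 + 1 < t) := trajectory0 t (lt_trans t01 t1t).
have x_cont t : t0 < t -> {for t, continuous x}.
  by move=> /trajectory0[dx [dF [xd _ _]]]; exact: is_derive_continuous xd.
have near0 : \forall t \near +oo, (0 : R) < t by exact: nbhs_pinfty_gt.
have AC_dom (AC : attouch_czarnecki dot h V (epsilon c delta) t0) w
    (w_opt : optimal_solution h V w) : dominated dot gradh V c delta (t0 + 1) x w.
  exact: (attouch_czarnecki_dominated dot_norm h_grad V_cont V_mono c_gt0 t0_gt0
    t01 x_cont w_opt AC).
split.
- move=> /AC_dom dom delta2; apply: littleo_near => r r0.
  apply: filterS (V_littleo dot_norm h_convex h_grad h_lb gradh_bounded V_mono
    c_gt0 delta_gt0 t1_gt0 trajectory xs_opt dom delta2 r0) => t.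
  by rewrite normr_id.
- move=> /AC_dom dom delta2; have delta_le : delta <= 2^-1 by rewrite delta2.
  have lower r := lower_bound_half dot_norm h_convex h_grad h_lb gradh_bounded
    V_cont V_mono c_gt0 delta_gt0 t1_gt0 trajectory xs_opt dom delta_le (r := r) delta2.
  have [[k Vk] gap _ hx weak] := slow_decay_rates dot_norm h_convex h_grad h_lb
    gradh_bounded V_cont V_mono c_gt0 delta_gt0 t1_gt0 trajectory xs_opt dom
    delta_le lower.
  split=> //; last exact: littleo_near.
  apply: (@bigO_near _ _ _ k); apply: filterS2 Vk near0 => t Vk t_gt0.
  by rewrite normr_id sqrt_powR ?(ltW t_gt0)// -[in t `^ 2^-1]delta2.
move=> rho rho_star /andP[rho1 _] conj sharp /andP[delta_gt delta_lt].
have rho0 : 0 < rho by exact: lt_trans rho1.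
have rhos0 : 0 < rho_star.
  rewrite -invr_gt0; have -> : rho_star^-1 = 1 - rho^-1 by rewrite -conj addrAC subrr add0r.
  by rewrite subr_gt0 invf_lt1.
have s1 : 1 < delta * rho_star by rewrite -ltr_pdivrMr// div1r.
have delta_le : delta <= 2^-1 by rewrite ltW.
have dom w (w_opt : optimal_solution h V w) :
    dominated dot gradh V c delta (t0 + 1) x w.
  exact: (sharpness_dominated dot_norm h_grad V_cont V_mono x c_gt0 rho1 conj rhos0
    t1_gt0 s1 w_opt sharp).
have lower (r : R) : 0 < r -> \forall t \near +oo, - (r / Num.sqrt t) <=
    epsilon c delta t * (h (x t) - h xs) + dot (x t - xs) (V (x t)) / 2.
  move=> r0.
  have [C C0 CP] := sharpness_bound dot_norm h_grad V_cont V_mono delta c_gt0 rho1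
    conj rhos0 xs_opt sharp.
  have s2 : 2^-1 < delta * rho_star by lra.
  apply: filterS2 (near_powR_le C r0 s2) near0 => t Ct t_gt0.
  rewrite sqrt_powR ?(ltW t_gt0)//.
  have e0 := epsilon_gt0 delta c_gt0 t_gt0.
  have := CP t (x t) t_gt0; rewrite powRN.
  have := ler_wpM2l (ltW e0) (gradient_le h_convex h_grad xs (x t)).
  have rt : 0 < r / t `^ 2^-1 by rewrite divr_gt0 ?powR_gt0.
  lra.
have [[k Vk] gap hrate _ weak] := slow_decay_rates dot_norm h_convex h_grad h_lb
  gradh_bounded V_cont V_mono c_gt0 delta_gt0 t1_gt0 trajectory xs_opt dom
  delta_le lower.
split=> //; [|exact: littleo_near|apply: littleo_near => r r0].
  by apply: (@bigO_near _ _ _ k); apply: filterS Vk => t Vk; rewrite normr_id.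
by apply: filterS (hrate r r0) => t; rewrite normr_id.
Qed.
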